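(* Let $\mathbb{K}$ be a field, $X$ a finite, faithful, indecomposable quandle, $\chi:X\times X\to\mathbb{K}^\times$ a 2-cocycle with diagonal elements $\chi(t,t)$ of order $m$, and assume that the associated Nichols algebra $\mathfrak{B}=\mathfrak{B}(X,\chi)$ is finite-dimensional. Let $X'$ be a non-empty proper subrack of $X$ and $\mathfrak{B}'$ its corresponding Nichols subalgebra of $\mathfrak{B}$. Then the Hilbert series $\mathcal{H}_{\mathfrak{B}}(t)$ is divisible (in $\mathbb{Z}[t]$) by $(m)_t\cdot\mathcal{H}_{\mathfrak{B}'}(t)$.
   Context: A rack is a set $X$ with a binary operation $\triangleright$ such that $t_1\triangleright(t_2\triangleright t_3)=(t_1\triangleright t_2)\triangleright(t_1\triangleright t_3)$ and each $g_t:X\to X$, $s\mapsto t\triangleright s$ is bijective. A quandle is a rack with $t\triangleright t=t$ for all $t$. $\mathrm{Inn}\,X$ is the permutation group generated by all $g_t$; $\mathrm{Env}\,X=\langle t\in X\mid s\cdot t=(s\triangleright t)\cdot s\ \forall s,t\in X\rangle$. $X$ is indecomposable if $\mathrm{Inn}\,X$ acts transitively on $X$, and faithful if $t\mapsto g_t$ is injective. A 2-cocycle is a map $\chi:X\times X\to\mathbb{K}^\times$ with $\chi(t,s\triangleright r)\chi(s,r)=\chi(t\triangleright s,t\triangleright r)\chi(t,r)$. For indecomposable $X$ the value $q=\chi(t,t)$ does not depend on $t$; its order is the minimal $m\ge 1$ with $q^m=1$ (finite whenever $\mathfrak{B}$ below is finite-dimensional). Let $V$ have basis $\{e_t\}_{t\in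 X}$ and put $g_t(e_s)=\chi(t,s)e_{t\triangleright s}$; this defines an action of $\mathrm{Env}\,X$ on $V$. The braiding is $c(e_t\otimes w)=g_t(w)\otimes e_t$. The tensor algebra $TV$ becomes a graded braided Hopf algebra, where $\Delta:TV\to TV\otimes TV$ is the algebra map for which all elements of $V$ are primitive, and $TV\otimes TV$ has the multiplication $(\mu\otimes\mu)(\mathrm{id}\otimes c\otimes\mathrm{id})$ with $c$ extended to $TV$. The Nichols algebra $\mathfrak{B}=\mathfrak{B}(X,\chi)$ is $TV/I$, where $I$ is the unique maximal homogeneous ideal and coideal (i.e. $\Delta(I)\subseteq I\otimes TV+TV\otimes I$) all of whose homogeneous elements have degree $\ge 2$. It is $\mathbb{Z}$-graded with each $e_t$ of degree $1$; $\mathfrak{B}(j)$ is the component of degree $j$. A subrack $X'\subseteq X$ is a subset which is a rack under $\triangleright$. The Nichols subalgebra corresponding to $X'$ is the unital subalgebra $\mathfrak{B}'$ of $\mathfrak{B}$ generated by $\{e_t:t\in X'\}$; it is the Nichols algebra of $X'$ with the restricted cocycle. The Hilbert series of a $\mathbb{Z}$-graded space $U$ with finite-dimensional components is $\mathcal{H}_U(t)=\sum_{j}\dim U(j)\,t^j$, and $(k)_t=1+t+\cdots+t^{k-1}$. *)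

(* Defs.v *)
From HB Require Import structures.
From mathcomp Require Import all_boot all_order all_algebra all_fingroup all_field.
From mathcomp Require Import finmap.
From mathcomp Require Import monalg.

Set Implicit Arguments.
Unset Strict Implicit.
Unset Printing Implicit Defensive.

Import GRing.Theory.
Local Open Scope ring_scope.

Section Racks.

Definition is_rack (T : Type) (op : T -> T -> T) : Prop :=
  (forall r s t, op r (op s t) = op (op r s) (op r t))
  /\ (forall t, bijective (op t)).

Definition is_quandle (T : Type) (op : T -> T -> T) : Prop :=
  is_rack op /\ (forall t, op t t = t).

Definition faithful_rack (T : Type) (op : T -> T -> T) : Prop :=
  forall s t, op s =1 op t -> s = t.

Variables (X : finType) (op : X -> X -> X).

Definition Inn : {set {perm X}} :=
  <<[set s : {perm X} | [exists t, [forall x, s x == op t x]]]>>%g.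

Definition indecomposable : bool := [transitive Inn, on [set: X] | 'P].

(* The subset Y is closed under op and is a rack for the restricted operation. *)
Definition subrack (Y : {set X}) : Prop :=
  exists2 opY : {x | x \in Y} -> {x | x \in Y} -> {x | x \in Y},
    (forall s t, val (opY s t) = op (val s) (val t)) & is_rack opY.

Definition cocycle (K : fieldType) (chi : X -> X -> K) : Prop :=
  (forall s t, chi s t != 0)
  /\ (forall t s r,
        chi t (op s r) * chi s r = chi (op t s) (op t r) * chi t r).

End Racks.

HB.lock Definition linext (K : fieldType) (G : choiceType) (U : lmodType K)
    (f : G -> U) (x : {malg K[G]}) : U :=
  \sum_(g <- msupp x) x@_g *: f g.
Arguments linext {K G U} f x.

Section LinearExtension.

Variables (K : fieldType) (G : choiceType) (U : lmodType K).

Lemma linextEw (f : G -> U) (d : {fset G}) x : (msupp x `<=` d)%fset ->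
  linext f x = \sum_(g <- d) x@_g *: f g.
Proof.
move=> le; rewrite linext.unlock (big_fset_incl _ le) => //= g _ /mcoeff_outdom ->.
by rewrite scale0r.
Qed.

Lemma linext_linear (f : G -> U) : linear (linext f).
Proof.
move=> a x y; pose d := (msupp x `|` msupp y)%fset.
have dx : (msupp x `<=` d)%fset by apply: fsubsetUl.
have dy : (msupp y `<=` d)%fset by apply: fsubsetUr.
have dxy : (msupp (a *: x + y) `<=` d)%fset.
  apply: fsubset_trans (msuppD_le _ _) _; rewrite fsubUset dy andbT.
  exact: fsubset_trans (msuppZ_le _ _) dx.
rewrite (linextEw f dx) (linextEw f dy) (linextEw f dxy).
rewrite scaler_sumr -big_split /=; apply: eq_bigr => g _.
by rewrite mcoeffD mcoeffZ scalerDl scalerA.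
Qed.

HB.instance Definition _ (f : G -> U) :=
  GRing.isLinear.Build K {malg K[G]} U *:%R (linext f) (linext_linear f).

Lemma linextU (f : G -> U) (g : G) : linext f << g >> = f g.
Proof. by rewrite (linextEw f msuppU_le) big_seq_fset1 mcoeffUU scale1r. Qed.

End LinearExtension.

Lemma linext_param (K : fieldType) (G : choiceType) (U V : lmodType K)
    (f : G -> V -> U) x :
  (forall g, linear (f g)) -> linear (fun v => linext (f^~ v) x).
Proof.
move=> lf a u v; rewrite !linext.unlock scaler_sumr -big_split /=.
by apply: eq_bigr => g _; rewrite lf scalerDr !scalerA mulrC.
Qed.

Lemma linear_fun0 (K : fieldType) (U V : lmodType K) (f : U -> V) :
  linear f -> f 0 = 0.
Proof. by move=> lf; rewrite -[0]addr0 -{1}[0](scaler0 _ (-1)) lf scaleN1r addNr. Qed.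

Lemma malg_ind (K : fieldType) (G : choiceType) (P : {malg K[G]} -> Prop) :
  P 0 -> (forall a x y, P x -> P y -> P (a *: x + y)) ->
  (forall g : G, P << g >>) -> forall x, P x.
Proof.
move=> P0 PD PU x; rewrite [x]monalgE; elim/big_rec: _ => // g y _ Py.
have -> : << x@_g *g g >> = x@_g *: (<< g >> : {malg K[G]}).
  by apply/malgP => h; rewrite mcoeffZ !mcoeffU mulrnAr mulr1.
exact: PD.
Qed.

(* For a vector space V with basis X, the tensor algebra TV is the algebra of
   the free monoid on X, and TV (x) TV has the pairs of words as a basis. *)
Notation tensor_algebra K X := {malg K[{fmonom X}]}.
Notation tensor_square K X := {malg K[({fmonom X} * {fmonom X})%type]}.

Definition gen (K : fieldType) (X : finType) (t : X) : tensor_algebra K X :=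
  << FMonom [:: t] >>.

HB.lock Definition tens (K : fieldType) (X : finType)
    (x y : tensor_algebra K X) : tensor_square K X :=
  linext (fun u => linext (fun v => << (u, v) >> : tensor_square K X) y) x.
Arguments tens {K X} x y.

(* The action of g_t on V, extended to TV by algebra automorphisms. *)
HB.lock Definition act (K : fieldType) (X : finType) (op : X -> X -> X)
    (chi : X -> X -> K) (t : X) (x : tensor_algebra K X) : tensor_algebra K X :=
  linext (fun w : {fmonom X} =>
    (\prod_(s <- w) chi t s) *:
      (<< FMonom (map (op t) w) >> : tensor_algebra K X)) x.
Arguments act {K X} op chi t x.

Definition act_word (K : fieldType) (X : finType) (op : X -> X -> X)
    (chi : X -> X -> K) (w : {fmonom X}) (x : tensor_algebra K X) :
    tensor_algebra K X :=
  foldr (act op chi) x w.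

(* The extension to TV of the braiding e_t (x) w |-> g_t(w) (x) e_t: a word
   t1 ... tk acts by the composite g_t1 ... g_tk. *)
HB.lock Definition braid (K : fieldType) (X : finType) (op : X -> X -> X)
    (chi : X -> X -> K) (p : tensor_square K X) : tensor_square K X :=
  linext (fun a : {fmonom X} * {fmonom X} =>
    tens (act_word op chi a.1 << a.2 >>) << a.1 >>) p.
Arguments braid {K X} op chi p.

(* (mu (x) mu) (id (x) c (x) id) *)
HB.lock Definition tens_mul (K : fieldType) (X : finType) (op : X -> X -> X)
    (chi : X -> X -> K) (p q : tensor_square K X) : tensor_square K X :=
  linext (fun a : {fmonom X} * {fmonom X} =>
    linext (fun b : {fmonom X} * {fmonom X} =>
      linext (fun d : {fmonom X} * {fmonom X} =>
          << (mmul a.1 d.1, mmul d.2 b.2) >> : tensor_square K X)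
        (braid op chi (tens << a.2 >> << b.1 >>))) q) p.
Arguments tens_mul {K X} op chi p q.

(* The algebra map with primitive generators, given by its values on words:
   see coprod_gen and coprodM below. *)
HB.lock Definition coprod (K : fieldType) (X : finType) (op : X -> X -> X)
    (chi : X -> X -> K) (x : tensor_algebra K X) : tensor_square K X :=
  linext (fun w : {fmonom X} =>
    foldr (fun t z =>
             tens_mul op chi (tens (gen K t) 1 + tens 1 (gen K t)) z)
          (tens 1 1) w) x.
Arguments coprod {K X} op chi x.

Section Coproduct.

Variables (K : fieldType) (X : finType) (op : X -> X -> X) (chi : X -> X -> K).

Local Notation word := {fmonom X}.
Local Notation TV := (tensor_algebra K X).
Local Notation TV2 := (tensor_square K X).

Local Notation gen := (@gen K X).
Local Notation tens := (@tens K X).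
Local Notation act := (act op chi).
Local Notation act_word := (act_word op chi).
Local Notation braid := (braid op chi).
Local Notation tens_mul := (tens_mul op chi).
Local Notation coprod := (coprod op chi).

Lemma wordM (u v : word) : << u >> * << v >> = << mmul u v >> :> TV.
Proof. by rewrite malgM_def fgmulUU mulr1. Qed.

Lemma tens_linl (y : TV) : linear (tens^~ y).
Proof. by rewrite tens.unlock; apply: linext_linear. Qed.

Lemma tens_linr (x : TV) : linear (tens x).
Proof. by rewrite tens.unlock; apply: linext_param => u a y z; apply: linext_linear. Qed.

Lemma tensU (u v : word) : tens << u >> << v >> = << (u, v) >>.
Proof. by rewrite tens.unlock !linextU. Qed.

Lemma act_linear t : linear (act t).
Proof. by rewrite act.unlock; apply: linext_linear. Qed.

Lemma braid_linear : linear braid.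
Proof. by rewrite braid.unlock; apply: linext_linear. Qed.

Lemma coprod_linear : linear coprod.
Proof. by rewrite coprod.unlock; apply: linext_linear. Qed.

Lemma act_gen t s : act t (gen s) = chi t s *: gen (op t s).
Proof. by rewrite act.unlock linextU big_seq1. Qed.

Lemma word1 : 1 = << FMonom [::] >> :> TV.
Proof. by congr << _ >>; apply/val_inj; rewrite /= fm1. Qed.

Lemma malg_scalerAr (a : K) (x y : TV) : a *: (x * y) = x * (a *: y).
Proof.
apply/malgP => w; rewrite mcoeffZ mcoeffMl.
rewrite (mcoeffMlw w (fsubset_refl _) (msuppZ_le a y)) mulr_sumr.
apply: eq_bigr => u _; rewrite mulr_sumr.
by apply: eq_bigr => v _; rewrite mcoeffZ mulrnAr mulrCA.
Qed.

Lemma malg_mulPl (a : K) (x y z : TV) : (a *: x + y) * z = a *: (x * z) + y * z.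
Proof. by rewrite mulrDl -scalerAl. Qed.

Lemma malg_mulPr (a : K) (x y z : TV) : x * (a *: y + z) = a *: (x * y) + x * z.
Proof. by rewrite mulrDr -malg_scalerAr. Qed.

Lemma act1 t : act t 1 = 1.
Proof. by rewrite word1 act.unlock linextU big_nil scale1r. Qed.

Lemma actU t (w : word) :
  act t << w >> = (\prod_(s <- w) chi t s) *: (<< FMonom (map (op t) w) >> : TV).
Proof. by rewrite act.unlock linextU. Qed.

Lemma actM t x y : act t (x * y) = act t x * act t y.
Proof.
have act0 : act t 0 = 0 by apply: linear_fun0 (act_linear t).
elim/malg_ind: x => [|a x1 x2 IH1 IH2|u]; first by rewrite mul0r act0 mul0r.
  by rewrite malg_mulPl act_linear IH1 IH2 act_linear malg_mulPl.
elim/malg_ind: y => [|a y1 y2 IH1 IH2|v]; first by rewrite mulr0 act0 mulr0.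
  by rewrite malg_mulPr act_linear IH1 IH2 act_linear malg_mulPr.
rewrite wordM (actU t u) (actU t v) (actU t (mmul u v)).
rewrite -scalerAl -malg_scalerAr scalerA wordM fmM big_cat map_cat /=.
by congr (_ *: << _ >>); apply/val_inj; rewrite /= fmM.
Qed.

Lemma act_word_linear w : linear (act_word w).
Proof.
rewrite /act_word => a x y; elim: (fmonom_val w) => [//|t s /= ->].
by rewrite act_linear.
Qed.

Lemma act_word1 w : act_word w 1 = 1.
Proof.
by rewrite /act_word; elim: (fmonom_val w) => [//|t s /= ->]; rewrite act1.
Qed.

Lemma act_wordM w x y : act_word w (x * y) = act_word w x * act_word w y.
Proof.
by rewrite /act_word; elim: (fmonom_val w) => [|t s /= ->]; rewrite ?actM.
Qed.

Lemma act_word_mul v w x : act_word (mmul v w) x = act_word v (act_word w x).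
Proof. by rewrite /act_word fmM foldr_cat. Qed.

Lemma tens0l (x : TV) : tens 0 x = 0.
Proof. exact: linear_fun0 (tens_linl x). Qed.

Lemma tens0r (x : TV) : tens x 0 = 0.
Proof. exact: linear_fun0 (tens_linr x). Qed.

Lemma braid_gen t x : braid (tens (gen t) x) = tens (act t x) (gen t).
Proof.
have act0 : act t 0 = 0 by apply: linear_fun0 (act_linear t).
elim/malg_ind: x => [|a x y IHx IHy|w].
- by rewrite act0 tens0l tens0r (linear_fun0 braid_linear).
- by rewrite tens_linr braid_linear IHx IHy act_linear tens_linl.
by rewrite tensU braid.unlock linextU.
Qed.

Lemma tens_mul_linl q : linear (tens_mul^~ q).
Proof. by rewrite tens_mul.unlock; apply: linext_linear. Qed.

Lemma tens_mul_linr p : linear (tens_mul p).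
Proof.
by rewrite tens_mul.unlock; apply: linext_param => a c x y; apply: linext_linear.
Qed.

Lemma tens_mul0l q : tens_mul 0 q = 0.
Proof. exact: linear_fun0 (tens_mul_linl q). Qed.

Lemma tens_mul0r p : tens_mul p 0 = 0.
Proof. exact: linear_fun0 (tens_mul_linr p). Qed.

Lemma tens_mulE (v : word) x y z :
  tens_mul (tens x << v >>) (tens y z) = tens (x * act_word v y) (<< v >> * z).
Proof.
have act0 : act_word v 0 = 0 by apply: linear_fun0 (act_word_linear v).
elim/malg_ind: x => [|a x1 x2 IH1 IH2|x].
- by rewrite mul0r !tens0l tens_mul0l.
- by rewrite tens_linl tens_mul_linl IH1 IH2 malg_mulPl tens_linl.
elim/malg_ind: z => [|a z1 z2 IH1 IH2|z].
- by rewrite mulr0 !tens0r tens_mul0r.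
- by rewrite tens_linr tens_mul_linr IH1 IH2 malg_mulPr tens_linr.
elim/malg_ind: y => [|a y1 y2 IH1 IH2|y].
- by rewrite act0 mulr0 !tens0l tens_mul0r.
- rewrite tens_linl tens_mul_linr IH1 IH2 act_word_linear.
  by rewrite malg_mulPr tens_linl.
rewrite !tensU tens_mul.unlock !linextU /= tensU braid.unlock linextU /=.
elim/malg_ind: (act_word v << y >>) => [|a y1 y2 IH1 IH2|y'].
- by rewrite mulr0 !tens0l; apply: linear_fun0 (linext_linear _).
- by rewrite tens_linl linext_linear IH1 IH2 malg_mulPr tens_linl.
by rewrite tensU linextU /= !wordM tensU.
Qed.

Lemma tens_ind (P : TV2 -> Prop) :
  P 0 -> (forall a p q, P p -> P q -> P (a *: p + q)) ->
  (forall u v : word, P (tens << u >> << v >>)) -> forall p, P p.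
Proof.
by move=> P0 PD PU; apply: malg_ind => // -[u v]; rewrite -tensU.
Qed.

Lemma tens_mulA p q r :
  tens_mul p (tens_mul q r) = tens_mul (tens_mul p q) r.
Proof.
elim/tens_ind: p => [|a p1 p2 IH1 IH2|u v]; first by rewrite !tens_mul0l.
  by rewrite !tens_mul_linl IH1 IH2.
elim/tens_ind: q => [|a q1 q2 IH1 IH2|u' v'].
- by rewrite tens_mul0l tens_mul0r tens_mul0l.
- by rewrite tens_mul_linl !tens_mul_linr IH1 IH2 tens_mul_linl.
elim/tens_ind: r => [|a r1 r2 IH1 IH2|u'' v''].
- by rewrite !tens_mul0r.
- rewrite [tens_mul (tens << u' >> _) _]tens_mul_linr.
  by rewrite [LHS]tens_mul_linr [RHS]tens_mul_linr IH1 IH2.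
rewrite !tens_mulE (wordM v v') [RHS]tens_mulE act_word_mul act_wordM.
by rewrite -(wordM v v') !mulrA.
Qed.

Lemma tens_mul1l p : tens_mul (tens 1 1) p = p.
Proof.
elim/tens_ind: p => [|a p1 p2 IH1 IH2|u v]; first by rewrite tens_mul0r.
  by rewrite tens_mul_linr IH1 IH2.
by rewrite {2}word1 tens_mulE -word1 /act_word /= !mul1r.
Qed.

Lemma coprod1 : coprod 1 = tens 1 1.
Proof. by rewrite {1}word1 coprod.unlock linextU. Qed.

Lemma coprod_gen t : coprod (gen t) = tens (gen t) 1 + tens 1 (gen t).
Proof.
have lin := tens_mul_linl (tens 1 1).
rewrite coprod.unlock linextU /=.
have g1 : tens_mul (tens (gen t) 1) (tens 1 1) = tens (gen t) 1.
  by rewrite {1}word1 tens_mulE -word1 act_word1 !mulr1.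
have g2 : tens_mul (tens 1 (gen t)) (tens 1 1) = tens 1 (gen t).
  by rewrite tens_mulE act_word1 !mulr1.
by rewrite -[tens (gen t) 1]scale1r lin g1 g2.
Qed.

Lemma coprodM x y : coprod (x * y) = tens_mul (coprod x) (coprod y).
Proof.
have coprod0 : coprod 0 = 0 by apply: linear_fun0 coprod_linear.
pose prim t := tens (gen t) 1 + tens 1 (gen t).
pose D (s : seq X) := foldr (fun t z => tens_mul (prim t) z) (tens 1 1) s.
have DU (w : word) : coprod << w >> = D w by rewrite coprod.unlock linextU.
have Dcat s r : D (s ++ r) = tens_mul (D s) (D r).
  elim: s => [|t s IH]; first exact: esym (tens_mul1l _).
  exact: etrans (congr1 (tens_mul (prim t)) IH) (tens_mulA _ _ _).
elim/malg_ind: x => [|a x1 x2 IH1 IH2|u].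
- by rewrite mul0r coprod0 tens_mul0l.
- by rewrite malg_mulPl coprod_linear IH1 IH2 coprod_linear tens_mul_linl.
elim/malg_ind: y => [|a y1 y2 IH1 IH2|v].
- by rewrite mulr0 coprod0 tens_mul0r.
- by rewrite malg_mulPr coprod_linear IH1 IH2 coprod_linear tens_mul_linr.
by rewrite wordM !DU fmM Dcat.
Qed.

Definition hcomp (n : nat) (x : TV) : TV :=
  linext (fun w : word => if size w == n then << w >> : TV else 0) x.

Definition homogeneous (n : nat) (x : TV) : Prop :=
  forall w : word, x@_w != 0 -> size w = n.

Definition coideal (J : TV -> Prop) : Prop :=
  forall x, J x ->
  exists r s : seq (TV * TV),
    [/\ forall p, p \in r -> J p.1,
        forall p, p \in s -> J p.2
      & coprod x = \sum_(p <- r) tens p.1 p.2 + \sum_(p <- s) tens p.1 p.2].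

Record admissible (J : TV -> Prop) : Prop := Admissible {
  adm0 : J 0;
  admP : forall (a : K) x y, J x -> J y -> J (a *: x + y);
  admMl : forall x y, J y -> J (x * y);
  admMr : forall x y, J x -> J (x * y);
  adm_hcomp : forall n x, J x -> J (hcomp n x);
  adm_deg : forall n x, J x -> x != 0 -> homogeneous n x -> (2 <= n)%N;
  adm_coideal : coideal J
}.

(* The largest admissible subset: see nichols_ideal_admissible below. *)
Definition nichols_ideal (x : TV) : Prop := exists2 J, admissible J & J x.

Lemma hcompE n x (w : word) : (hcomp n x)@_w = x@_w *+ (size w == n).
Proof.
rewrite /hcomp linext.unlock raddf_sum /= [in RHS](monalgE x) raddf_sum /= -sumrMnl.
apply: eq_bigr => v _; rewrite mcoeffZ mcoeffU.
case: (eqVneq v w) => [->|ne]; case: eqP => _;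
  by rewrite ?mcoeffU ?eqxx ?(negbTE ne) ?mcoeff0 /= ?mulr0 ?mulr1 ?mul0rn.
Qed.

Lemma hcomp_homogeneous n x : homogeneous n (hcomp n x).
Proof.
move=> w; rewrite hcompE; have [//|_] := eqVneq (size w) n.
by rewrite mulr0n eqxx.
Qed.

Lemma homogeneous_hcomp n x : homogeneous n x -> hcomp n x = x.
Proof.
move=> hx; apply/malgP => w; rewrite hcompE.
case: (eqVneq x@_w 0) => [->|nz]; first by rewrite mul0rn.
by rewrite (hx _ nz) eqxx.
Qed.

Lemma admissible_add J1 J2 : admissible J1 -> admissible J2 ->
  admissible (fun z => exists x y, [/\ J1 x, J2 y & z = x + y]).
Proof.
move=> A1 A2; split.
- by exists 0, 0; rewrite addr0; split; [apply: adm0 A1|apply: adm0 A2|].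
- move=> a _ _ [x1 [y1 [Jx1 Jy1 ->]]] [x2 [y2 [Jx2 Jy2 ->]]].
  exists (a *: x1 + x2), (a *: y1 + y2).
  by rewrite scalerDr addrACA; split; [apply: admP|apply: admP|].
- move=> z _ [x [y [Jx Jy ->]]]; exists (z * x), (z * y).
  by rewrite mulrDr; split; [apply: admMl|apply: admMl|].
- move=> _ z [x [y [Jx Jy ->]]]; exists (x * z), (y * z).
  by rewrite mulrDl; split; [apply: admMr|apply: admMr|].
- move=> n _ [x [y [Jx Jy ->]]]; exists (hcomp n x), (hcomp n y).
  by rewrite /hcomp linearD; split; [apply: adm_hcomp|apply: adm_hcomp|].
- move=> n _ [x [y [Jx Jy ->]]] nz /homogeneous_hcomp h.
  have low J u : admissible J -> J u -> (n < 2)%N -> hcomp n u = 0.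
    move=> A Ju; apply: contraTeq => nzu; rewrite -leqNgt.
    exact: adm_deg A _ _ (adm_hcomp A n Ju) nzu (@hcomp_homogeneous n u).
  rewrite leqNgt; apply: contraNN nz => lt2.
  by rewrite -h /hcomp linearD /= -!/(hcomp _ _) (low J1) ?(low J2) ?addr0.
move=> _ [x [y [Jx Jy ->]]].
have [r1 [s1 [r1P s1P e1]]] := adm_coideal A1 Jx.
have [r2 [s2 [r2P s2P e2]]] := adm_coideal A2 Jy.
exists (r1 ++ r2), (s1 ++ s2); split.
- move=> p; rewrite mem_cat => /orP[/r1P Jp|/r2P Jp].
    by exists p.1, 0; rewrite addr0; split=> //; apply: adm0 A2.
  by exists 0, p.1; rewrite add0r; split=> //; apply: adm0 A1.
- move=> p; rewrite mem_cat => /orP[/s1P Jp|/s2P Jp].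
    by exists p.2, 0; rewrite addr0; split=> //; apply: adm0 A2.
  by exists 0, p.2; rewrite add0r; split=> //; apply: adm0 A1.
by rewrite -[x]scale1r coprod_linear scale1r e1 e2 !big_cat /= addrACA.
Qed.

Lemma nichols_ideal_admissible : admissible nichols_ideal.
Proof.
have sub J : admissible J -> forall x, J x -> nichols_ideal x.
  by move=> A x Jx; exists J.
split.
- exists (fun x => x = 0) => //; split=> //.
  + by move=> a _ _ -> ->; rewrite scaler0 addr0.
  + by move=> x _ ->; rewrite mulr0.
  + by move=> _ y ->; rewrite mul0r.
  + by move=> n _ ->; rewrite /hcomp linear0.
  + by move=> n _ ->; rewrite eqxx.
  by move=> _ ->; exists [::], [::]; rewrite !big_nil addr0 (linear_fun0 coprod_linear).
- move=> a x y [J1 A1 J1x] [J2 A2 J2y].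
  apply: (sub _ (admissible_add A1 A2)); exists (a *: x), y; split=> //.
  by rewrite -[a *: x]addr0; apply: (admP A1) => //; apply: adm0.
- by move=> x y [J A Jy]; apply: (sub J A); apply: admMl.
- by move=> x y [J A Jx]; apply: (sub J A); apply: admMr.
- by move=> n x [J A Jx]; apply: (sub J A); apply: adm_hcomp.
- by move=> n x [J A Jx]; apply: (adm_deg A).
move=> x [J A Jx]; have [r [s [rP sP e]]] := adm_coideal A Jx.
by exists r, s; split=> // p /[dup] ? => [/rP|/sP]; apply: sub.
Qed.

Lemma nichols_ideal_max J : admissible J -> forall x, J x -> nichols_ideal x.
Proof. by move=> A x Jx; exists J. Qed.

End Coproduct.

Section NicholsAlgebra.

Variables (K : fieldType) (X : finType) (op : X -> X -> X) (chi : X -> X -> K).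
Variables (B : falgType K) (pi : {lrmorphism tensor_algebra K X -> B}).

(* The finite-dimensional algebra B, with projection pi, is the quotient of
   the tensor algebra by the ideal nichols_ideal. *)
Definition is_nichols_algebra : Prop :=
  (forall b : B, exists x, pi x = b)
  /\ (forall x, pi x = 0 <-> nichols_ideal op chi x).

Definition grade (j : nat) : {vspace B} :=
  <<[seq pi (<< FMonom (val w) >>)%R | w : j.-tuple X]>>%VS.

Definition nichols_subalgebra (Y : {set X}) : {vspace B} :=
  agenv <<[seq pi (gen K t) | t in Y]>>%VS.

(* H is the Hilbert series of the graded subspace U of B. *)
Definition hilbert_series (U : {vspace B}) (H : {poly int}) : Prop :=
  forall j, H`_j = (\dim (U :&: grade j)%VS)%:Z.

End NicholsAlgebra.

Definition q_number (k : nat) : {poly int} := \sum_(i < k) 'X^i.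

(* Main.v *)
From HB Require Import structures.
Require Import Defs.
From mathcomp Require Import all_boot all_order all_algebra all_fingroup all_field.
From mathcomp Require Import finmap.
From mathcomp Require Import monalg.

Set Implicit Arguments.
Unset Strict Implicit.
Unset Printing Implicit Defensive.

Import GRing.Theory.
Local Open Scope ring_scope.

(** Let B' be the subalgebra of the Nichols algebra B that belongs to the
    subrack [Y].  The proof factors the Hilbert series of B twice.

    On the tensor algebra there are two families of skew derivations: [rder t]
    extracts e_t from the last factor of the coproduct and [lder t] extracts it
    from the first one.  By coassociativity the two families commute.  A tensor
    lies in the Nichols ideal if and only if all its iterated right derivations
    have constant term zero ([nichols_idealE]), so both families descend to B.

    Let W be the space of those elements of B that all [rder s] with s in [Y]
    annihilate.  Multiplication from W (x) B' to B is bijective.  Indeed the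
    derivations along words in [Y] are left W-linear, they separate the points
    of B', and every linear relation between them that holds on B' holds on B:
    such a derivation is the contraction of the coproduct with a linear form
    that vanishes on the words with a letter outside of [Y] ([rders_dual]).
    Hence H_B = H_B' H_W ([hilbert_coinvariants]).

    Since [Y] is proper there is some t outside of [Y].  Left multiplication
    by e_t preserves W, because [rder s] annihilates e_t for s in [Y], and
    [lder t] preserves W, because it commutes with [rder s].  On W these two
    operators satisfy the q-Weyl relation
      [lder t] (e_t x) = x + q e_t [lder t] x, where q = [chi t t] has order m.
    If m > 1 then the m-th power of [lder t] is zero ([lder_nilpotent]), so W is
    the direct sum of the e_t^i W0 for i < m, where W0 is the kernel of [lder t]
    on W.  Hence the q-number of m divides H_W ([hilbert_q_weyl]).

    Both decompositions are instances of [graded_decomposition]. *)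

(** * Graded decompositions from triangular systems of operators *)

(** [U] is to be the direct sum of the translates [f i W].  The operators
    [phi i] invert the [f i] only in a triangular sense: an iterated skew
    derivation is dual to one translate, annihilates those of smaller degree,
    but may take nonzero values on those of larger degree. *)
Section GradedDecomposition.

Variables (K : fieldType) (V : vectType K) (gr : nat -> {vspace V}).
Variables (U W : {vspace V}) (I : finType) (deg : I -> nat).
Variables (f phi : I -> 'End(V)).

Hypothesis f_homog : forall i n w,
  w \in (W :&: gr n)%VS -> f i w \in (U :&: gr (n + deg i))%VS.
Hypothesis phi_homog : forall i n x, x \in gr (n + deg i) -> phi i x \in gr n.
Hypothesis phi_low : forall i n x, (n < deg i)%N -> x \in gr n -> phi i x = 0.
Hypothesis phi_f : forall i j w, w \in W -> (deg j <= deg i)%N ->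
  phi i (f j w) = if i == j then w else 0.
Hypothesis phi_top : forall i x, x \in U ->
  (forall j, (deg i < deg j)%N -> phi j x = 0) -> phi i x \in W.
Hypothesis phi_sep : forall x, x \in U -> (forall i, phi i x = 0) -> x = 0.

Let piece n i := (f i @: (W :&: gr (n - deg i)))%VS.

Lemma piece_dim n i : \dim (piece n i) = \dim (W :&: gr (n - deg i)).
Proof.
apply: limg_dim_eq; apply/eqP; rewrite -subv0; apply/subvP => w.
rewrite memv_cap => /andP[/[!memv_cap]/andP[wW _] /[!memv_ker]/eqP fw0].
by have := phi_f wW (leqnn (deg i)); rewrite eqxx fw0 linear0 => <-; apply: mem0v.
Qed.

Lemma pieces_direct n : directv (\sum_(i | (deg i <= n)%N) piece n i).
Proof.
apply/directv_sum_independent => us us_in sum0.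
have [ws wsW ws_us] : exists2 ws : I -> V,
    (forall i, (deg i <= n)%N -> ws i \in W)
    & (forall i, (deg i <= n)%N -> us i = f i (ws i)).
  have /fin_all_exists[ws wsP] : forall i, exists w,
      (deg i <= n)%N -> w \in W /\ us i = f i w.
    move=> i; have [len|_] := leqP (deg i) n; last by exists 0.
    have /memv_imgP[w /[!memv_cap]/andP[wW _] ->] := us_in i len.
    by exists w.
  by exists ws => i /wsP[].
(* [k] bounds [n - deg i], so the components of highest degree vanish first. *)
suff top0 k : forall i, (deg i <= n)%N -> (n <= deg i + k)%N -> us i = 0.
  by move=> i len; apply: (top0 n) => //; apply: leq_addl.
elim/ltn_ind: k => k IH i len ge_n.
have : phi i (\sum_(j | (deg j <= n)%N) us j) = 0 by rewrite sum0 linear0.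
rewrite linear_sum (bigD1 i) //= big1 ?addr0 => [|j /andP[lejn nij]].
  by rewrite ws_us // phi_f ?wsW // eqxx => ->; rewrite linear0.
have [leji|ltij] := leqP (deg j) (deg i).
  by rewrite ws_us // phi_f ?wsW // eq_sym (negbTE nij).
rewrite (IH (n - deg j)%N) ?linear0 //; last by rewrite subnKC.
by rewrite ltn_subLR //; apply: leq_ltn_trans ge_n _; rewrite ltn_add2r.
Qed.

Lemma pieces_span n : (\sum_(i | (deg i <= n)%N) piece n i = U :&: gr n)%VS.
Proof.
have sub : (\sum_(i | (deg i <= n)%N) piece n i <= U :&: gr n)%VS.
  apply/subv_sumP => i len; apply/subvP => _ /memv_imgP[w wW ->].
  by have := f_homog i wW; rewrite subnK.
apply/eqP; rewrite eqEsubv sub /=; apply/subvP => x.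
(* The components of highest degree are split off first. *)
suff H k : (k <= n.+1)%N -> forall y, y \in (U :&: gr n)%VS ->
    (forall i, (k <= deg i)%N -> phi i y = 0) ->
    y \in (\sum_(i | (deg i <= n)%N) piece n i)%VS.
  move=> xU; apply: (H n.+1) => // i lti; apply: phi_low lti _.
  by move: xU; rewrite memv_cap => /andP[].
elim: k => [|k IH] lek y yU high.
  suff -> : y = 0 by apply: mem0v.
  by apply: phi_sep => [|i]; [move: yU; rewrite memv_cap => /andP[] | apply: high].
move: (yU); rewrite memv_cap => /andP[yUU yn].
pose z := \sum_(i | deg i == k) f i (phi i y).
have phiW i : deg i = k -> phi i y \in (W :&: gr (n - deg i))%VS.
  move=> di; rewrite memv_cap phi_top ?phi_homog //= ?subnK ?di //.
have zin : z \in (\sum_(i | (deg i <= n)%N) piece n i)%VS.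
  apply: memv_suml => i /eqP di.
  have /subvP : (piece n i <= \sum_(i | (deg i <= n)%N) piece n i)%VS.
    by apply: (sumv_sup i); rewrite ?di ?subvv.
  by apply; apply/memv_img/phiW.
rewrite -(subrK z y) memvD // IH ?(ltnW lek) //.
  by rewrite memvB //; apply: (subvP sub).
move=> i lei; rewrite linearB linear_sum /=; apply/eqP; rewrite subr_eq0.
have phi_term j : deg j == k -> phi i (f j (phi j y)) = if i == j then phi j y else 0.
  move=> /eqP dj; rewrite phi_f ?dj //.
  by have := phiW _ dj; rewrite memv_cap => /andP[].
rewrite (eq_bigr _ phi_term); have [dik|ndik] := eqVneq (deg i) k.
  rewrite (bigD1 i) ?dik //= eqxx big1 ?addr0 // => j /andP[_ nji].
  by rewrite eq_sym (negbTE nji).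
rewrite high ?big1 // => [j /eqP dj|]; last by rewrite ltn_neqAle eq_sym ndik.
by case: eqP => // eij; rewrite eij dj eqxx in ndik.
Qed.

(** Applying [phi i] to a sum of terms [f j (w j)] of degree at most [deg i]
    isolates [w i]; this makes the sum of the translates direct.  Conversely,
    subtracting from [x] the terms [f i (phi i x)] of highest degree leaves an
    element that more of the [phi i] annihilate, so the translates span. *)
Lemma graded_decomposition (HU HW : {poly int}) :
  (forall n, HU`_n = (\dim (U :&: gr n))%:Z) ->
  (forall n, HW`_n = (\dim (W :&: gr n))%:Z) ->
  HU = (\sum_i 'X^(deg i)) * HW.
Proof.
move=> HUE HWE; apply/polyP => n; rewrite HUE -pieces_span.
rewrite (directvP (pieces_direct n)) /= mulr_suml coef_sum.
rewrite -[LHS]natz natr_sum /= big_mkcond /=; apply: eq_bigr => i _.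
rewrite coefXnM ltnNge; case: leqP => //= _.
by rewrite piece_dim HWE natz.
Qed.

End GradedDecomposition.

(** The matrix of the functionals in a basis of [U] has independent rows;
    a right inverse of it expresses the coordinates by the functionals. *)
Lemma dual_functionals (K : fieldType) (E : vectType K) (U : {vspace E})
    (T : finType) (lam : T -> {linear E -> K^o}) :
  (forall v, v \in U -> (forall t, lam t v = 0) -> v = 0) ->
  exists N : 'I_(\dim U) -> T -> K, forall i v, v \in U ->
    \sum_t N i t * lam t v = coord (vbasis U) i v.
Proof.
move=> sep; pose M := \matrix_(i < \dim U, t < #|T|) (lam (enum_val t) (vbasis U)`_i : K).
have /row_freeP[N MN] : row_free M.
  rewrite -kermx_eq0; apply/eqP/row_matrixP => i.
  rewrite row0; set r := row i _.
  have rM : r *m M = 0 by apply/sub_kermxP; apply: row_sub.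
  pose v := \sum_j r 0 j *: (vbasis U)`_j.
  have vU : v \in U by apply: memv_suml => j _; rewrite memvZ // vbasis_mem // memt_nth.
  have v0 : v = 0.
    apply: sep => // t; rewrite linear_sum /=.
    have /rowP/(_ (enum_rank t)) := rM; rewrite mxE [in RHS]mxE => rMt.
    rewrite -[RHS]rMt.
    by apply: eq_bigr => j _; rewrite !mxE enum_rankK linearZ.
  apply/rowP => j; rewrite [RHS]mxE.
  by rewrite -(coord_sum_free (r 0) j (basis_free (vbasisP U))) -/v v0 linear0.
exists (fun i t => N (enum_rank t) i) => i v vU.
rewrite [in LHS](coord_vbasis vU).
transitivity (\sum_j coord (vbasis U) j v * (M *m N) j i).
  transitivity (\sum_t \sum_j N (enum_rank t) i *
      lam t (coord (vbasis U) j v *: (vbasis U)`_j)).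
    by apply: eq_bigr => t _; rewrite linear_sum mulr_sumr.
  rewrite exchange_big /=; apply: eq_bigr => j _; rewrite mxE mulr_sumr.
  rewrite (reindex (@enum_rank T)) /=; last by apply: onW_bij; apply: enum_rank_bij.
  apply: eq_bigr => t _; rewrite !mxE enum_rankK linearZ /=.
  by rewrite mulrCA [N _ _ * _]mulrC.
rewrite (bigD1 i) //= MN mxE eqxx mulr1 big1 ?addr0 // => j nji.
by rewrite mxE (negbTE nji) mulr0.
Qed.

(** * The tensor square *)

(** Locked, because products of tensors unfold to large terms that are slow to
    tell apart during rewriting. *)
HB.lock Definition gmul (K : fieldType) (X : finType) (t : X)
    (x : tensor_algebra K X) : tensor_algebra K X := gen K t * x.
Arguments gmul {K X} t x.

Lemma malgUZ (K : fieldType) (G : choiceType) (c : K) (g : G) :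
  << c *g g >> = c *: << g >> :> {malg K[G]}.
Proof. by apply/malgP => h; rewrite mcoeffZ !mcoeffU mulrnAr mulr1. Qed.

Section BilinearTensor.

Variables (K : fieldType) (X : finType) (op : X -> X -> X) (chi : X -> X -> K).

Local Notation word := {fmonom X}.
Local Notation TV := (tensor_algebra K X).
Local Notation TV2 := (tensor_square K X).

HB.instance Definition _ t :=
  GRing.isLinear.Build K TV TV *:%R (Defs.act op chi t) (act_linear op chi t).
HB.instance Definition _ :=
  GRing.isLinear.Build K TV TV2 *:%R (coprod op chi) (coprod_linear op chi).
HB.instance Definition _ x :=
  GRing.isLinear.Build K TV TV2 *:%R (tens x) (tens_linr x).
HB.instance Definition _ p :=
  GRing.isLinear.Build K TV2 TV2 *:%R (tens_mul op chi p) (tens_mul_linr op chi p).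

Lemma tensDl (x y z : TV) : tens (x + y) z = tens x z + tens y z.
Proof. by have := tens_linl z 1 x y; rewrite !scale1r. Qed.

Lemma tensZl a (x z : TV) : tens (a *: x) z = a *: tens x z.
Proof. by have := tens_linl z a x 0; rewrite !addr0 tens0l addr0. Qed.

Lemma tensBl (x y z : TV) : tens (x - y) z = tens x z - tens y z.
Proof. by rewrite tensDl -scaleN1r tensZl scaleN1r. Qed.

Lemma tens_suml (J : Type) (r : seq J) (F : J -> TV) y :
  tens (\sum_(j <- r) F j) y = \sum_(j <- r) tens (F j) y.
Proof. exact: (big_morph (tens^~ y) (fun x z => tensDl x z y) (tens0l y)). Qed.

Lemma tens_mulDl (p q r : TV2) :
  tens_mul op chi (p + q) r = tens_mul op chi p r + tens_mul op chi q r.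
Proof. by have := tens_mul_linl op chi r 1 p q; rewrite !scale1r. Qed.

Lemma gmulE t (x : TV) : gmul t x = gen K t * x.
Proof. by rewrite gmul.unlock. Qed.

Lemma gmulA t (x y : TV) : gmul t x * y = gmul t (x * y).
Proof. by rewrite !gmulE mulrA. Qed.

Lemma gmul_linear t : linear (gmul t : TV -> TV).
Proof. by move=> a x y; rewrite !gmulE malg_mulPr. Qed.

HB.instance Definition _ t :=
  GRing.isLinear.Build K TV TV *:%R (gmul t) (gmul_linear t).

Lemma gmul_word t (w : seq X) :
  gmul t << FMonom w >> = << FMonom (t :: w) >> :> TV.
Proof. by rewrite gmulE wordM; congr << _ >>; apply/val_inj; rewrite /= fmM. Qed.

Lemma tensor_ind (P : TV -> Prop) :
  P 0 -> (forall a x y, P x -> P y -> P (a *: x + y)) ->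
  P 1 -> (forall t x, P x -> P (gmul t x)) -> forall x, P x.
Proof.
move=> P0 PD P1 PM; apply: malg_ind => // -[w].
by elim: w => [|t w IH]; rewrite -?word1 // -gmul_word; apply: PM.
Qed.

Lemma linear_eq_word (U : lmodType K) (f g : {linear TV -> U}) :
  f 1 = g 1 -> (forall t x, f x = g x -> f (gmul t x) = g (gmul t x)) ->
  f =1 g.
Proof.
move=> e1 eM; apply: tensor_ind => // [|a x y ex ey]; first by rewrite !linear0.
by rewrite !linearP ex ey.
Qed.

(** The tensor product of two linear maps.  Its values on pairs of words
    determine it, so linearity is asked for only in [tmapE]. *)
Definition tmap (f g : TV -> TV) : TV2 -> TV2 :=
  linext (fun p => tens (f << p.1 >>) (g << p.2 >>)).

HB.instance Definition _ f g := GRing.Linear.on (tmap f g).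

Lemma tmapE (f g : {linear TV -> TV}) x y :
  tmap f g (tens x y) = tens (f x) (g y).
Proof.
elim/malg_ind: x => [|a x1 x2 IH1 IH2|u].
- by rewrite linear0 !tens0l linear0.
- by rewrite [f _]linearP !(tensDl, tensZl) linearP /= IH1 IH2.
elim/malg_ind: y => [|a y1 y2 IH1 IH2|v].
- by rewrite !linear0.
- by rewrite !linearP /= IH1 IH2.
by rewrite tensU /tmap linextU.
Qed.

(** The contractions of the right, respectively left, tensor factor with the
    linear form that reads off the coefficient of the word [v]. *)
Definition contractr (v : word) : TV2 -> TV :=
  linext (fun p => (p.2 == v)%:R *: << p.1 >>).
Definition contractl (v : word) : TV2 -> TV :=
  linext (fun p => (p.1 == v)%:R *: << p.2 >>).

HB.instance Definition _ v := GRing.Linear.on (contractr v).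
HB.instance Definition _ v := GRing.Linear.on (contractl v).

Lemma contractrE v x y : contractr v (tens x y) = y@_v *: x.
Proof.
elim/malg_ind: x => [|a x1 x2 IH1 IH2|u].
- by rewrite tens0l linear0 scaler0.
- by rewrite !(tensDl, tensZl) linearP /= IH1 IH2 scalerDr !scalerA mulrC.
elim/malg_ind: y => [|a y1 y2 IH1 IH2|w].
- by rewrite !linear0 scale0r.
- by rewrite !linearP /= IH1 IH2 scalerDl scalerA.
by rewrite tensU /contractr linextU mcoeffU.
Qed.

Lemma contractlE v x y : contractl v (tens x y) = x@_v *: y.
Proof.
elim/malg_ind: y => [|a y1 y2 IH1 IH2|w].
- by rewrite !linear0.
- by rewrite [tens _ _]linearP [LHS]linearP /= IH1 IH2 scalerDr !scalerA mulrC.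
elim/malg_ind: x => [|a x1 x2 IH1 IH2|u].
- by rewrite tens0l linear0 mcoeff0 scale0r.
- by rewrite !(tensDl, tensZl) linearP /= IH1 IH2 mcoeffD mcoeffZ scalerDl scalerA.
by rewrite tensU /contractl linextU mcoeffU.
Qed.

Lemma mcoeff_gmul t (x : TV) (w : seq X) :
  (gmul t x)@_(FMonom w) =
  if w is s :: w' then x@_(FMonom w') *+ (s == t) else 0.
Proof.
elim/malg_ind: x => [|a x y IHx IHy|[u]].
- by rewrite linear0 mcoeff0; case: w => // s w; rewrite mcoeff0 mul0rn.
- rewrite [gmul t _]linearP mcoeffD mcoeffZ IHx IHy; case: w {IHx IHy} => [|s w].
    by rewrite mulr0 addr0.
  by rewrite mcoeffD mcoeffZ mulrnDl mulrnAr.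
rewrite gmul_word mcoeffU -val_eqE /=; case: w => //= s w.
by rewrite mcoeffU -val_eqE /= eqseq_cons [t == s]eq_sym andbC -mulnb mulrnA.
Qed.

Lemma tens_mul_gen1 t (x y : TV) :
  tens_mul op chi (tens (gen K t) 1) (tens x y) = tens (gmul t x) y.
Proof. by rewrite gmulE word1 tens_mulE /act_word /= -word1 mul1r. Qed.

Lemma tens_mul_1gen t x y :
  tens_mul op chi (tens 1 (gen K t)) (tens x y) = tens (Defs.act op chi t x) (gmul t y).
Proof. by rewrite gmulE tens_mulE mul1r. Qed.

Lemma coprod_gmul t (x : TV) : coprod op chi (gmul t x) =
  tens_mul op chi (tens (gen K t) 1) (coprod op chi x) +
  tens_mul op chi (tens 1 (gen K t)) (coprod op chi x).
Proof. by rewrite gmulE coprodM coprod_gen tens_mulDl. Qed.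

End BilinearTensor.

(** * Skew derivations of the tensor algebra *)

Section Derivations.

Variables (K : fieldType) (X : finType) (op : X -> X -> X) (chi : X -> X -> K).
Hypotheses (rack : is_rack op) (coc : cocycle op chi).

Local Notation word := {fmonom X}.
Local Notation TV := (tensor_algebra K X).
Local Notation TV2 := (tensor_square K X).
Local Notation act := (Defs.act op chi).
Local Notation coprod := (coprod op chi).
Local Notation tens_mul := (tens_mul op chi).
Local Notation gen := (gen K).

Lemma op_inj s : injective (op s).
Proof. exact/bij_inj/rack.2. Qed.

Lemma act_gmul s t x : act s (gmul t x) = chi s t *: gmul (op s t) (act s x).
Proof. by rewrite !gmulE Defs.actM act_gen -scalerAl. Qed.

(** Self-distributivity takes care of the index and the cocycle condition of
    the scalars: the action respects the relations of the enveloping group. *)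
Lemma act_act s t x : act s (act t x) = act (op s t) (act s x).
Proof.
apply: (linear_eq_word (f := act s \o act t) (g := act (op s t) \o act s)) => [|r {}x /= e] /=.
  by rewrite !Defs.act1.
rewrite (act_gmul t) (act_gmul s r) !linearZ /= (act_gmul s) (act_gmul (op s t)) e.
rewrite -rack.1.
rewrite !scalerA.
by rewrite [chi s r * _]mulrC -coc.2 mulrC.
Qed.

Lemma tmap_act_gen1 s t p :
  tmap (act s) (act s) (tens_mul (tens (gen t) 1) p) =
  chi s t *: tens_mul (tens (gen (op s t)) 1) (tmap (act s) (act s) p).
Proof.
elim/tens_ind: p => [|a x y IHx IHy|u v]; first by rewrite !linear0.
  by rewrite !linearP /= IHx IHy !scalerA mulrC.
by rewrite tmapE !tens_mul_gen1 tmapE /= act_gmul tensZl.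
Qed.

Lemma tmap_act_1gen s t p :
  tmap (act s) (act s) (tens_mul (tens 1 (gen t)) p) =
  chi s t *: tens_mul (tens 1 (gen (op s t))) (tmap (act s) (act s) p).
Proof.
elim/tens_ind: p => [|a x y IHx IHy|u v]; first by rewrite !linear0.
  by rewrite !linearP /= IHx IHy !scalerA mulrC.
by rewrite tmapE !tens_mul_1gen tmapE /= act_gmul linearZ act_act.
Qed.

(** The action respects the braiding by [act_act], hence also the braided
    product of the tensor square. *)
Lemma coprod_act s x : coprod (act s x) = tmap (act s) (act s) (coprod x).
Proof.
apply: (linear_eq_word (f := coprod \o act s)
          (g := tmap (act s) (act s) \o coprod)) => [|t {}x /= e] /=.
  by rewrite Defs.act1 !coprod1 tmapE /= Defs.act1.
rewrite act_gmul linearZ /= !coprod_gmul e.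
by rewrite [RHS]linearD /= tmap_act_gen1 tmap_act_1gen scalerDr.
Qed.

Local Notation nil := (FMonom [::] : word).
Local Notation letter t := (FMonom [:: t] : word).

Lemma mcoeff1_word w : (1 : TV)@_(FMonom w) = (w == [::])%:R.
Proof. by rewrite word1 mcoeffU1 -val_eqE /= eq_sym. Qed.

Lemma mcoeff_act_nil s x : (act s x)@_nil = x@_nil.
Proof.
elim/tensor_ind: x => [|a x y IHx IHy||t x IH]; first by rewrite linear0.
- by rewrite [act s _]linearP /= !mcoeffD !mcoeffZ IHx IHy.
- by rewrite Defs.act1.
by rewrite act_gmul mcoeffZ !mcoeff_gmul mulr0.
Qed.

Lemma mcoeff_act_letter s t x :
  (act s x)@_(letter (op s t)) = chi s t * x@_(letter t).
Proof.
elim/tensor_ind: x => [|a x y IHx IHy||r x IH].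
- by rewrite !linear0 mulr0.
- by rewrite [act s _]linearP /= !mcoeffD !mcoeffZ IHx IHy mulrDr mulrCA.
- by rewrite Defs.act1 !mcoeff1_word mulr0.
rewrite act_gmul mcoeffZ !mcoeff_gmul mcoeff_act_nil (inj_eq (@op_inj s)).
by case: eqVneq => [->|_]; rewrite ?mulr1n ?mulr0n ?mulr0.
Qed.

Lemma coprod_counitr x : contractr nil (coprod x) = x.
Proof.
apply: (linear_eq_word (f := contractr nil \o coprod) (g := idfun)) => [|t {}x /= e] /=.
  by rewrite coprod1 contractrE mcoeff1_word scale1r.
rewrite coprod_gmul linearD /= -[in RHS]e.
elim/tens_ind: (coprod x) {e} => [|a p q IHp IHq|u v].
- by rewrite !linear0 addr0.
- by rewrite !linearP /= -IHp -IHq scalerDr addrACA.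
rewrite tens_mul_gen1 tens_mul_1gen !contractrE mcoeff_gmul scale0r addr0.
by rewrite linearZ.
Qed.

Lemma coprod_counitl x : contractl nil (coprod x) = x.
Proof.
apply: (linear_eq_word (f := contractl nil \o coprod) (g := idfun)) => [|t {}x /= e] /=.
  by rewrite coprod1 contractlE mcoeff1_word scale1r.
rewrite coprod_gmul linearD /= -[in RHS]e.
elim/tens_ind: (coprod x) {e} => [|a p q IHp IHq|u v].
- by rewrite !linear0 addr0.
- by rewrite !linearP /= -IHp -IHq scalerDr addrACA.
rewrite tens_mul_gen1 tens_mul_1gen !contractlE mcoeff_gmul scale0r add0r.
by rewrite mcoeff_act_nil linearZ.
Qed.

(** The right and left skew derivations.  The braiding twists their Leibniz
    rules differently: in [rder_gmul] it acts on the argument, in [lder_gmul] it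
    moves the index of the derivation. *)
Definition rder t x := contractr (letter t) (coprod x).
Definition lder t x := contractl (letter t) (coprod x).

HB.instance Definition _ t := GRing.Linear.copy (rder t) (contractr (letter t) \o coprod).
HB.instance Definition _ t := GRing.Linear.copy (lder t) (contractl (letter t) \o coprod).

Lemma rder1 t : rder t 1 = 0.
Proof. by rewrite /rder coprod1 contractrE mcoeff1_word scale0r. Qed.

Lemma lder1 t : lder t 1 = 0.
Proof. by rewrite /lder coprod1 contractlE mcoeff1_word scale0r. Qed.

Lemma rder_gmul t s x :
  rder t (gmul s x) = gmul s (rder t x) + (s == t)%:R *: act t x.
Proof.
rewrite /rder coprod_gmul linearD /=; congr (_ + _).
  elim/tens_ind: (coprod x) => [|a p q IHp IHq|u v].
  - by rewrite !linear0.
  - by rewrite !linearP /= -IHp -IHq.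
  by rewrite tens_mul_gen1 !contractrE linearZ.
rewrite -[in RHS](coprod_counitr x); elim/tens_ind: (coprod x) => [|a p q IHp IHq|u v].
- by rewrite !linear0.
- by rewrite !linearP /= IHp IHq.
rewrite tens_mul_1gen !contractrE mcoeff_gmul linearZ /= scalerA eq_sym.
by case: eqVneq => [->|_]; [rewrite mulr1n mul1r | rewrite mulr0n mul0r !scale0r].
Qed.

(** In the second summand e_s moves past an e_r in the first tensor factor, and
    the braiding turns this e_r into a multiple of the generator with index
    [op s r]. *)
Lemma lder_gmul s r x :
  lder (op s r) (gmul s x) = (s == op s r)%:R *: x + chi s r *: gmul s (lder r x).
Proof.
rewrite /lder coprod_gmul linearD /=; congr (_ + _).
  rewrite -[in RHS](coprod_counitl x); elim/tens_ind: (coprod x) => [|a p q IHp IHq|u v].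
  - by rewrite !linear0.
  - by rewrite !linearP /= IHp IHq.
  rewrite tens_mul_gen1 !contractlE mcoeff_gmul scalerA eq_sym.
  by case: eqP => _; rewrite ?mulr1n ?mul1r ?mulr0n ?mul0r.
elim/tens_ind: (coprod x) => [|a p q IHp IHq|u v].
- by rewrite !linear0.
- by rewrite !linearP /= IHp IHq.
by rewrite tens_mul_1gen !contractlE mcoeff_act_letter linearZ scalerA mulrC.
Qed.

Lemma rderM t x y : rder t (x * y) = x * rder t y + rder t x * act t y.
Proof.
elim/tensor_ind: x => [|a x1 x2 IH1 IH2||s x IH].
- by rewrite !mul0r linear0 mul0r addr0.
- rewrite malg_mulPl; move: (x1 * y) (x2 * y) IH1 IH2 => u1 u2 IH1 IH2.
  rewrite [LHS]linearP /= IH1 IH2.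
  rewrite [rder t (_ + _)]linearP /=.
  rewrite !malg_mulPl.
  by rewrite scalerDr addrACA.
- by rewrite !mul1r rder1 mul0r addr0.
rewrite gmulA.
rewrite !rder_gmul IH.
rewrite Defs.actM.
rewrite [(_ + _) * act t y]mulrDl.
rewrite -scalerAl.
rewrite !gmulA.
rewrite [gmul s (_ + _)]linearD /=.
by rewrite addrA.
Qed.

Lemma tmap_rder_gen1 t s p :
  tmap idfun (rder t) (tens_mul (tens (gen s) 1) p) =
  tens_mul (tens (gen s) 1) (tmap idfun (rder t) p).
Proof.
elim/tens_ind: p => [|a x y IHx IHy|u v]; first by rewrite !linear0.
  by rewrite !linearP /= IHx IHy.
by rewrite !tmapE !tens_mul_gen1 tmapE.
Qed.

Lemma tmap_rder_1gen t s p :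
  tmap idfun (rder t) (tens_mul (tens 1 (gen s)) p) =
  tens_mul (tens 1 (gen s)) (tmap idfun (rder t) p) +
  (s == t)%:R *: tmap (act t) (act t) p.
Proof.
elim/tens_ind: p => [|a x y IHx IHy|u v]; first by rewrite !linear0 addr0.
  by rewrite !linearP /= IHx IHy scalerDr addrACA.
rewrite !tmapE tens_mul_1gen tens_mul_1gen tmapE /= rder_gmul linearD linearZ /=.
by case: eqVneq => [->|_]; rewrite ?scale0r.
Qed.

(** Coassociativity, with one tensor factor contracted to the coefficient of
    e_t. *)
Lemma coprod_rder t x : coprod (rder t x) = tmap idfun (rder t) (coprod x).
Proof.
apply: (linear_eq_word (f := coprod \o rder t)
         (g := tmap idfun (rder t) \o coprod)) => [|s {}x /= e] /=.
  by rewrite rder1 linear0 coprod1 tmapE /= rder1 linear0.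
rewrite rder_gmul [LHS]linearD linearZ /= coprod_act !coprod_gmul e.
by rewrite [RHS]linearD /= tmap_rder_gen1 tmap_rder_1gen addrA.
Qed.

Lemma rder_act s t x : rder (op s t) (act s x) = chi s t *: act s (rder t x).
Proof.
have swap (r : X) (V : lmodType K) (u v : V) :
    chi s r *: (chi s t *: u) + chi s r *: ((r == t)%:R *: v) =
    chi s t *: (chi s r *: u) + chi s t *: ((r == t)%:R *: v).
  rewrite !scalerA mulrC; congr (_ + _).
  by case: eqVneq => [->|_]; rewrite ?mulr0.
apply: (linear_eq_word (f := rder (op s t) \o act s)
         (g := chi s t \*: (act s \o rder t))) => [|r {}x /= e] /=.
  by rewrite Defs.act1 !rder1 linear0 scaler0.
rewrite act_gmul.
rewrite [LHS]linearZ /=.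
rewrite rder_gmul.
rewrite e.
rewrite [rder t (gmul _ _)]rder_gmul.
rewrite -(act_act s t x).
rewrite (inj_eq (@op_inj s)).
rewrite [act s (_ + _)]linearD /= act_gmul.
rewrite [act s (_ *: _)]linearZ /=.
rewrite [gmul _ (_ *: _)]linearZ /=.
rewrite !scalerDr.
by apply: swap.
Qed.

(** The two derivations act on opposite factors of the coproduct. *)
Lemma lder_rder s t x : lder t (rder s x) = rder s (lder t x).
Proof.
rewrite /lder coprod_rder; elim/tens_ind: (coprod x) => [|a p q IHp IHq|u v].
- by rewrite !linear0.
- by rewrite !linearP /= IHp IHq.
by rewrite tmapE !contractlE linearZ.
Qed.

Definition rders (w : seq X) x := foldl (fun y t => rder t y) x w.

Lemma rders_linear w : linear (rders w).
Proof. by elim: w => [|t w IH] a x y //=; rewrite linearP IH. Qed.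

HB.instance Definition _ w :=
  GRing.isLinear.Build K TV TV *:%R (rders w) (rders_linear w).

Lemma rders_cons t w x : rders (t :: w) x = rders w (rder t x).
Proof. by []. Qed.

Lemma rders_rcons t w x : rders (rcons w t) x = rder t (rders w x).
Proof. by rewrite /rders foldl_rcons. Qed.

Lemma coprod_rders w x : coprod (rders w x) = tmap idfun (rders w) (coprod x).
Proof.
elim: w x => [|t w IH] x.
  rewrite [rders _ _]/=; elim/tens_ind: (coprod x) => [|a p q IHp IHq|u v].
  - by rewrite linear0.
  - by rewrite linearP /= -IHp -IHq.
  by rewrite tmapE.
rewrite rders_cons IH coprod_rder; elim/tens_ind: (coprod x) => [|a p q IHp IHq|u v].
- by rewrite !linear0.
- by rewrite !linearP /= IHp IHq.
by rewrite !tmapE.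
Qed.

(** * The radical of the iterated derivations *)

(** Up to the order of the letters, the values of these forms on the words of
    length [size w] are the entries of the quantum symmetrizer. *)
Definition word_form w x : K := (rders w x)@_nil.

Lemma word_formP w a x y : word_form w (a *: x + y) = a * word_form w x + word_form w y.
Proof. by rewrite /word_form linearP mcoeffD mcoeffZ. Qed.

Lemma word_form0 w : word_form w 0 = 0.
Proof. by rewrite /word_form linear0 mcoeff0. Qed.

Lemma word_formZ w a x : word_form w (a *: x) = a * word_form w x.
Proof. by rewrite -[a *: x]addr0 word_formP word_form0 addr0. Qed.

Lemma word_formB w x y : word_form w (x - y) = word_form w x - word_form w y.
Proof. by rewrite addrC -scaleN1r word_formP mulN1r addrC. Qed.

Lemma word_form_sum w (J : Type) (r : seq J) (F : J -> TV) :
  word_form w (\sum_(j <- r) F j) = \sum_(j <- r) word_form w (F j).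
Proof.
apply: (big_morph (word_form w) _ (word_form0 w)) => x y.
by rewrite -[x]scale1r word_formP scale1r mul1r.
Qed.

Lemma word_form_rder t w x : word_form w (rder t x) = word_form (t :: w) x.
Proof. by []. Qed.

Lemma word_form_rders v w x : word_form w (rders v x) = word_form (v ++ w) x.
Proof. by rewrite /word_form /rders foldl_cat. Qed.

Lemma word_form_act s w x : word_form (map (op s) w) (act s x) = (\prod_(r <- w) chi s r) * word_form w x.
Proof.
elim: w x => [|t w IH] x; first by rewrite big_nil mul1r /word_form mcoeff_act_nil.
by rewrite /= -word_form_rder rder_act word_formZ IH big_cons -mulrA.
Qed.

(** The largest subspace without constant terms that is stable under all
    [rder t], see [radical_intro]. *)
Definition radical x := forall w, word_form w x = 0.

Lemma radical0 : radical 0. Proof. by move=> w; rewrite word_form0. Qed.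

Lemma radicalP a x y : radical x -> radical y -> radical (a *: x + y).
Proof. by move=> hx hy w; rewrite word_formP hx hy mulr0 addr0. Qed.

Lemma radical_rder t x : radical x -> radical (rder t x).
Proof. by move=> hx w; rewrite word_form_rder. Qed.

Lemma radical_act t x : radical x -> radical (act t x).
Proof.
move=> hx w; have [g gK Kg] := rack.2 t.
have -> : w = map (op t) (map g w) by rewrite -map_comp (eq_map Kg) map_id.
by rewrite word_form_act hx mulr0.
Qed.

Lemma radical_nil x : radical x -> x@_nil = 0.
Proof. exact: (fun h => h [::]). Qed.

(** That the radical is an ideal follows from this, applied to sets such as
    [gen t * radical + radical]. *)
Lemma radical_intro (P : TV -> Prop) :
  (forall x, P x -> x@_nil = 0) -> (forall t x, P x -> P (rder t x)) ->
  forall x, P x -> radical x.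
Proof. by move=> P0 Pd x Px w; elim: w x Px => [|t w IH] x Px; [apply: P0|apply: IH; apply: Pd]. Qed.

Lemma radical_gmul t x : radical x -> radical (gmul t x).
Proof.
move=> hx; pose P y := exists2 u, radical u & exists2 v, radical v & y = gmul t u + v.
apply: (@radical_intro P); last by exists x => //; exists 0; [apply: radical0|rewrite addr0].
  by move=> _ [u hu [v hv ->]]; rewrite mcoeffD mcoeff_gmul add0r radical_nil.
move=> s _ [u hu [v hv ->]]; exists (rder s u); first exact: radical_rder.
exists ((t == s)%:R *: act s u + rder s v).
  by apply: radicalP; [apply: radical_act|apply: radical_rder].
by rewrite linearD /= rder_gmul addrA.
Qed.

Lemma radicalMl x y : radical y -> radical (x * y).
Proof.
move=> hy; elim/tensor_ind: x => [|a u v hu hv||t u hu].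
- by rewrite mul0r; apply: radical0.
- by rewrite malg_mulPl; apply: radicalP.
- by rewrite mul1r.
by rewrite gmulA; apply: radical_gmul.
Qed.

Lemma mcoeff_mul_nil (x y : TV) : (x * y)@_nil = x@_nil * y@_nil.
Proof.
elim/tensor_ind: x => [|a u v hu hv||t u hu].
- by rewrite mul0r mcoeff0 mul0r.
- rewrite malg_mulPl; move: (u * y) (v * y) hu hv => uy vy hu hv.
  by rewrite !mcoeffD !mcoeffZ hu hv mulrDl mulrA.
- by rewrite mul1r mcoeff1_word mul1r.
by rewrite gmulA !mcoeff_gmul mul0r.
Qed.

Lemma rder_gen t s : rder t (gen s) = (s == t)%:R *: 1.
Proof. by rewrite -[gen s]mulr1 -gmulE rder_gmul rder1 linear0 add0r Defs.act1. Qed.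

Lemma radicalMr x y : radical x -> radical (x * y).
Proof.
have radical_mul_gen t u : radical u -> radical (u * gen t).
  move=> hu; pose P z := exists s v, [/\ radical v
    & exists2 v', radical v' & z = v * gen s + v'].
  apply: (@radical_intro P); last first.
    by exists t, u; split=> //; exists 0; [apply: radical0|rewrite addr0].
    move=> s _ [r [v [hv [v' hv' ->]]]]; exists (op s r), (chi s r *: rder s v).
    split; first by rewrite -[_ *: _]addr0; apply: radicalP radical0; apply: radical_rder.
    exists ((r == s)%:R *: v + rder s v').
      by apply: radicalP => //; apply: radical_rder.
    rewrite linearD /= rderM act_gen rder_gen -!malg_scalerAr mulr1 -scalerAl.
    by rewrite -addrA; apply: addrCA.
  move=> _ [s [v [hv [v' hv' ->]]]]; rewrite mcoeffD mcoeff_mul_nil.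
  by rewrite (radical_nil hv) (radical_nil hv') mul0r addr0.
elim/tensor_ind: y x => [|a u v hu hv||t u hu] x hx.
- by rewrite mulr0; apply: radical0.
- by rewrite malg_mulPr; apply: radicalP; [apply: hu|apply: hv].
- by rewrite mulr1.
by rewrite gmulE mulrA; apply: hu; apply: radical_mul_gen.
Qed.

(** * Homogeneous components *)

Local Notation hcomp := (@hcomp K X).

Lemma hcomp_linear n : linear (hcomp n).
Proof. exact: linext_linear. Qed.

HB.instance Definition _ n :=
  GRing.isLinear.Build K TV TV *:%R (hcomp n) (hcomp_linear n).

Lemma hcomp_word n (w : seq X) :
  hcomp n << FMonom w >> = (size w == n)%:R *: << FMonom w >>.
Proof. by rewrite /Defs.hcomp linextU; case: ifP => _; rewrite ?scale1r ?scale0r. Qed.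

Lemma hcomp1 n : hcomp n 1 = (n == 0)%:R *: 1.
Proof. by rewrite word1 hcomp_word eq_sym. Qed.

Lemma hcomp_gmulS n t x : hcomp n.+1 (gmul t x) = gmul t (hcomp n x).
Proof.
elim/malg_ind: x => [|a u v hu hv|[w]]; first by rewrite !linear0.
  by rewrite !linearP /= hu hv.
by rewrite gmul_word !hcomp_word linearZ /= gmul_word.
Qed.

Lemma hcomp_gmul0 t x : hcomp 0 (gmul t x) = 0.
Proof.
elim/malg_ind: x => [|a u v hu hv|[w]]; first by rewrite !linear0.
  by rewrite !linearP /= hu hv scaler0 addr0.
by rewrite gmul_word hcomp_word scale0r.
Qed.

Lemma hcomp_act n t x : hcomp n (act t x) = act t (hcomp n x).
Proof.
elim/tensor_ind: x n => [|a u v hu hv||s u hu] n; first by rewrite !linear0.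
- by rewrite !linearP /= hu hv.
- by rewrite Defs.act1 hcomp1 linearZ /= Defs.act1.
rewrite act_gmul linearZ /=; case: n => [|n].
  by rewrite !hcomp_gmul0 scaler0 linear0.
by rewrite !hcomp_gmulS hu act_gmul.
Qed.

Lemma rder_hcomp0 t x : rder t (hcomp 0 x) = 0.
Proof.
elim/tensor_ind: x => [|a u v hu hv||s u hu]; first by rewrite !linear0.
- by rewrite !linearP /= hu hv scaler0 addr0.
- by rewrite hcomp1 linearZ /= rder1 scaler0.
by rewrite hcomp_gmul0 linear0.
Qed.

Lemma rder_hcompS n t x : rder t (hcomp n.+1 x) = hcomp n (rder t x).
Proof.
elim/tensor_ind: x n => [|a u v hu hv||s u hu] n; first by rewrite !linear0.
- by rewrite !linearP /= hu hv.
- by rewrite hcomp1 scale0r rder1 !linear0.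
rewrite hcomp_gmulS !rder_gmul [hcomp n (_ + _)]linearD linearZ /= hcomp_act.
congr (_ + _); case: n => [|n]; last by rewrite hu hcomp_gmulS.
by rewrite rder_hcomp0 linear0 hcomp_gmul0.
Qed.

Lemma mcoeff_rder_nil t x : (rder t x)@_nil = x@_(letter t).
Proof.
elim/tensor_ind: x => [|a u v hu hv||s u hu]; first by rewrite linear0 !mcoeff0.
- by rewrite [rder t _]linearP /= !mcoeffD !mcoeffZ hu hv.
- by rewrite rder1 mcoeff0 mcoeff1_word.
rewrite rder_gmul mcoeffD mcoeffZ !mcoeff_gmul add0r mcoeff_act_nil eq_sym.
by case: (t == s); rewrite ?mul1r ?mul0r.
Qed.

Lemma word_form_hcomp w n x : word_form w (hcomp n x) = if size w == n then word_form w x else 0.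
Proof.
elim: w n x => [|t w IH] n x /=.
  by rewrite /word_form /= hcompE /=; case: eqP.
rewrite -word_form_rder; case: n => [|n]; first by rewrite rder_hcomp0 word_form0.
by rewrite rder_hcompS IH.
Qed.

Lemma word_form_word w (v : seq X) : size v != size w -> word_form w << FMonom v >> = 0.
Proof.
move=> ne; have : word_form w (hcomp (size v) << FMonom v >>) = 0.
  by rewrite word_form_hcomp eq_sym (negbTE ne).
by rewrite hcomp_word eqxx scale1r.
Qed.

(** * The Nichols ideal is the radical *)

(** Modulo the radical, a short word is determined by finitely many forms.  With
    M the matrix of the values of the forms on the words of length at most [N],
    the [a w] are read off from a matrix P such that M P M = M. *)
Lemma radical_approx N : exists a : N.-bseq X -> TV,
  forall u : word, (size u <= N)%N ->
    radical (<< u >> - \sum_(w : N.-bseq X) word_form w << u >> *: a w).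
Proof.
pose T : finType := N.-bseq X.
pose bs (i : 'I_#|T|) : seq X := enum_val i.
pose M := \matrix_(i < #|T|, j < #|T|) (word_form (bs j) << FMonom (bs i) >> : K).
pose P := pinvmx M.
exists (fun w => \sum_i P (enum_rank w) i *: << FMonom (bs i) >>) => u leN w.
have [lew|ltw] := leqP (size w) N; last first.
  rewrite word_formB word_form_sum big1 => [|w' _].
    by rewrite subr0; case: u leN => u leN; rewrite word_form_word // neq_ltn (leq_ltn_trans leN).
  rewrite word_formZ word_form_sum big1 ?mulr0 // => i _.
  rewrite word_formZ word_form_word ?mulr0 //.
  by rewrite neq_ltn (leq_ltn_trans (size_bseq _)).
pose iu := enum_rank (Bseq leN : T); pose iw := enum_rank (Bseq lew : T).
have uE : << u >> = << FMonom (bs iu) >> :> TV.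
  by congr << _ >>; apply/val_inj; rewrite /= /bs enum_rankK.
have wE : w = bs iw by rewrite /bs enum_rankK.
rewrite uE wE word_formB word_form_sum; apply/eqP; rewrite subr_eq0; apply/eqP.
have -> : word_form (bs iw) << FMonom (bs iu) >> = M iu iw by rewrite mxE.
rewrite -[in LHS](mulmxKpV (submx_refl M)) -/P mxE.
transitivity (\sum_(w' : T) word_form w' << FMonom (bs iu) >> *
    \sum_i P (enum_rank w') i * M i iw); last first.
  apply: eq_bigr => w' _; rewrite word_formZ word_form_sum; congr (_ * _).
  by apply: eq_bigr => i _; rewrite word_formZ [M i iw]mxE.
transitivity (\sum_j M iu j * \sum_i P j i * M i iw).
  rewrite (eq_bigr (fun i => \sum_j M iu j * P j i * M i iw)) => [|i _].
    rewrite exchange_big; apply: eq_bigr => j _; rewrite mulr_sumr.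
    by apply: eq_bigr => i _; rewrite mulrA.
  by rewrite mxE mulr_suml.
rewrite (reindex (@enum_rank T)) /=; last by apply: onW_bij; apply: enum_rank_bij.
by apply: eq_bigr => w' _; rewrite mxE /bs enum_rankK.
Qed.

(** The tensor product of the forms of [w] and [w']. *)
Definition word_form2 w w' (z : TV2) : K := word_form w (contractr nil (tmap idfun (rders w') z)).

Lemma word_form2E w w' x y : word_form2 w w' (tens x y) = word_form w x * word_form w' y.
Proof. by rewrite /word_form2 tmapE contractrE word_formZ mulrC. Qed.

Lemma word_form2_coprod w w' x : word_form2 w w' (coprod x) = word_form (w' ++ w) x.
Proof. by rewrite /word_form2 -coprod_rders coprod_counitr word_form_rders. Qed.

(** Write E for the approximation by the [a w].  Then (E (x) E) z = 0, and
    u (x) v - E u (x) E v = (u - E u) (x) v + E u (x) (v - E v). *)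
Lemma radical_tens z : (forall w w', word_form2 w w' z = 0) ->
  exists r s : seq (TV * TV),
    [/\ forall p, p \in r -> radical p.1,
        forall p, p \in s -> radical p.2
      & z = \sum_(p <- r) tens p.1 p.2 + \sum_(p <- s) tens p.1 p.2].
Proof.
have telescope (V : lmodType K) (c : K) (x y v : V) :
    c *: x - c *: v = c *: (x - y) + c *: (y - v).
  by rewrite -scalerDr addrA subrK scalerBr.
move=> z0; pose N := (\max_(p <- msupp z) maxn (size p.1) (size p.2))%N.
have [a aP] := radical_approx N.
pose E (x : TV) := \sum_(w : N.-bseq X) word_form w x *: a w.
have zE : z = \sum_(p <- msupp z) z@_p *: tens << p.1 >> << p.2 >>.
  rewrite {1}[z]monalgE; apply: eq_bigr => -[u v] _; rewrite tensU.
  exact: malgUZ.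
have zEE : \sum_(p <- msupp z) z@_p *: tens (E << p.1 >>) (E << p.2 >>) = 0.
  transitivity (\sum_(p <- msupp z) \sum_(w : N.-bseq X) \sum_(w' : N.-bseq X)
     (z@_p * word_form2 w w' (tens << p.1 >> << p.2 >>)) *: tens (a w) (a w')).
    apply: eq_bigr => p _; rewrite tens_suml scaler_sumr; apply: eq_bigr => w _.
    rewrite tensZl scalerA /E [tens _ _]linear_sum /= scaler_sumr; apply: eq_bigr => w' _.
    by rewrite word_form2E [tens _ (_ *: _)]linearZ /= scalerA mulrA.
  rewrite exchange_big; apply: big1 => w _.
  rewrite exchange_big; apply: big1 => w' _.
  rewrite -scaler_suml; apply/eqP; rewrite scaler_eq0; apply/orP; left.
  apply/eqP; rewrite -[RHS](z0 w w') [in RHS]zE /word_form2 linear_sum /= linear_sum /= word_form_sum.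
  by apply: eq_bigr => p _; rewrite !linearZ /= word_formZ.
exists [seq (z@_p *: (<< p.1 >> - E << p.1 >>), << p.2 >>) | p <- msupp z],
       [seq (E << p.1 >>, z@_p *: (<< p.2 >> - E << p.2 >>)) | p <- msupp z].
have szN p : p \in msupp z -> (maxn (size p.1) (size p.2) <= N)%N.
  by move=> pz; rewrite /N (bigD1_seq p) ?fset_uniq //= leq_maxl.
split.
- move=> _ /mapP[p /szN + ->]; rewrite geq_max => /andP[le1 _] /=.
  by rewrite -[_ *: _]addr0; apply: radicalP radical0; apply: aP.
- move=> _ /mapP[p /szN + ->]; rewrite geq_max => /andP[_ le2] /=.
  by rewrite -[_ *: _]addr0; apply: radicalP radical0; apply: aP.
rewrite [LHS]zE -[LHS]subr0 -[X in _ - X]zEE -sumrB !big_map -big_split /=.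
apply: eq_bigr => -[u v] _ /=.
move: (E << u >>) (E << v >>) => Eu Ev.
rewrite tensZl tensBl [tens Eu (_ *: _)]linearZ /= [tens Eu (_ - _)]linearB /=.
exact: telescope.
Qed.

(** For the coideal property: the tensor product of two forms, evaluated on the
    coproduct of [x], is the form of the concatenated word at [x]. *)
Lemma radical_admissible : admissible op chi radical.
Proof.
split.
- exact: radical0.
- exact: radicalP.
- exact: radicalMl.
- exact: radicalMr.
- by move=> n x hx w; rewrite word_form_hcomp; case: ifP.
- move=> n x hx nz hom; rewrite leqNgt; apply: contra nz => lt2.
  apply/eqP/malgP => -[w]; rewrite mcoeff0; apply/eqP; apply: contraT => nzw.
  have /= sz := hom _ nzw; case: w nzw sz => [|t [|? ?]] nzw sz.
  + by rewrite (radical_nil hx) eqxx in nzw.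
  + by rewrite -mcoeff_rder_nil (radical_nil (radical_rder t hx)) eqxx in nzw.
  by rewrite -sz in lt2.
by move=> x hx; apply: radical_tens => w w'; rewrite word_form2_coprod.
Qed.

(** The radical is admissible, so the maximal admissible ideal contains it.
    Conversely that ideal is stable under derivations, because it is a coideal
    without components of degree less than two. *)
Lemma nichols_idealE x : nichols_ideal op chi x <-> radical x.
Proof.
split=> [|hx]; last by exists radical => //; apply: radical_admissible.
have adm := nichols_ideal_admissible op chi.
have low n y : nichols_ideal op chi y -> (n < 2)%N -> hcomp n y = 0.
  move=> Iy; apply: contraTeq => nz; rewrite -leqNgt.
  exact: adm_deg adm _ _ (adm_hcomp adm n Iy) nz (@hcomp_homogeneous _ _ n y).
have low_coef (w : word) y : nichols_ideal op chi y -> (size w < 2)%N -> y@_w = 0.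
  by move=> Iy /(low _ _ Iy)/malgP/(_ w); rewrite hcompE eqxx mcoeff0.
apply: radical_intro => [{}x|t {}x] Ix; first exact: low_coef.
have [r [s [rP sP e]]] := adm_coideal adm Ix.
have sumI (l : seq (TV * TV)) : (forall p, p \in l -> nichols_ideal op chi p.1) ->
    nichols_ideal op chi (\sum_(p <- l) p.2@_(letter t) *: p.1).
  elim: l => [|p l IH] lP; first by rewrite big_nil; apply: adm0 adm.
  rewrite big_cons; apply: admP adm _ _ _ _ _; first by apply: lP; rewrite mem_head.
  by apply: IH => q ql; apply: lP; rewrite in_cons ql orbT.
rewrite /rder e linearD /= !linear_sum /=.
rewrite [X in _ + X]big1_seq ?addr0 => [|p /andP[_ ps]].
  rewrite (eq_bigr (fun p => p.2@_(letter t) *: p.1)) => [|p _].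
    exact: sumI.
  by rewrite contractrE.
by rewrite contractrE (low_coef (letter t)) ?scale0r //; apply: sP.
Qed.

(** * Left derivations *)

Lemma mcoeff_lder_nil t x : (lder t x)@_nil = x@_(letter t).
Proof.
elim/tensor_ind: x => [|a u v hu hv||s u hu]; first by rewrite linear0 !mcoeff0.
- by rewrite [lder t _]linearP /= !mcoeffD !mcoeffZ hu hv.
- by rewrite lder1 mcoeff0 mcoeff1_word.
have [g _ gK] := rack.2 s; rewrite -[in LHS](gK t) lder_gmul // gK.
rewrite mcoeffD !mcoeffZ !mcoeff_gmul mulr0 addr0 eq_sym.
by case: (t == s); rewrite ?mul1r ?mul0r.
Qed.

Lemma rders_lder w t x : rders w (lder t x) = lder t (rders w x).
Proof. by elim: w x => [|s w IH] x //; rewrite !rders_cons -lder_rder IH. Qed.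

Lemma radical_lder t x : radical x -> radical (lder t x).
Proof.
move=> hx w; rewrite /word_form rders_lder mcoeff_lder_nil -mcoeff_rder_nil.
by rewrite -rders_rcons; apply: hx.
Qed.

Lemma radical_rders w x : radical x -> radical (rders w x).
Proof. by elim: w x => [|t w IH] x hx //; rewrite rders_cons; apply: IH; apply: radical_rder. Qed.

Lemma lder_hcomp0 t x : lder t (hcomp 0 x) = 0.
Proof.
elim/tensor_ind: x => [|a u v hu hv||s u hu]; first by rewrite !linear0.
- by rewrite !linearP /= hu hv scaler0 addr0.
- by rewrite hcomp1 linearZ /= lder1 scaler0.
by rewrite hcomp_gmul0 linear0.
Qed.

Lemma lder_hcompS n t x : lder t (hcomp n.+1 x) = hcomp n (lder t x).
Proof.
elim/tensor_ind: x n t => [|a u v hu hv||s u hu] n t; first by rewrite !linear0.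
- by rewrite !linearP /= hu hv.
- by rewrite hcomp1 scale0r lder1 !linear0.
have [g _ gK] := rack.2 s; rewrite -(gK t) hcomp_gmulS !lder_gmul //.
rewrite [hcomp n (_ + _)]linearD !linearZ /=; congr (_ + _ *: _).
case: n => [|n]; last by rewrite hu hcomp_gmulS.
by rewrite lder_hcomp0 linear0 hcomp_gmul0.
Qed.

Lemma rders_hcomp w n x : rders w (hcomp n x) =
  if (size w <= n)%N then hcomp (n - size w) (rders w x) else 0.
Proof.
elim: w n x => [|t w IH] [|n] x; rewrite ?rders_cons ?subn0 //=.
  by rewrite rder_hcomp0 linear0.
by rewrite rder_hcompS IH subSS.
Qed.

Lemma hcomp0E x : hcomp 0 x = x@_nil *: 1.
Proof.
elim/tensor_ind: x => [|a u v hu hv||s u hu].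
- by rewrite linear0 mcoeff0 scale0r.
- by rewrite linearP /= hu hv mcoeffD mcoeffZ scalerDl scalerA.
- by rewrite hcomp1 mcoeff1_word.
by rewrite hcomp_gmul0 mcoeff_gmul scale0r.
Qed.

Lemma hcompM n k x y :
  hcomp (n + k) (hcomp n x * hcomp k y) = hcomp n x * hcomp k y.
Proof.
elim/tensor_ind: x n => [|a u v hu hv||s u hu] n.
- by rewrite linear0 mul0r linear0.
- rewrite [hcomp n (_ + _)]linearP /= malg_mulPl.
  move: (hcomp n u * _) (hcomp n v * _) (hu n) (hv n) => u' v' hu' hv'.
  by rewrite linearP /= hu' hv'.
- rewrite hcomp1; case: n => [|n]; last by rewrite scale0r mul0r linear0.
  by rewrite scale1r mul1r; apply/malgP => w; rewrite !hcompE; case: eqP.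
case: n => [|n]; first by rewrite hcomp_gmul0 mul0r linear0.
by rewrite hcomp_gmulS gmulA addSn hcomp_gmulS hu.
Qed.

Lemma hcomp_large x : exists n, forall k, (n <= k)%N -> hcomp k x = 0.
Proof.
elim/malg_ind: x => [|a x y [n1 h1] [n2 h2]|[w]].
- by exists 0 => k _; rewrite linear0.
- exists (maxn n1 n2) => k; rewrite geq_max => /andP[le1 le2].
  by rewrite linearP /= h1 // h2 // scaler0 addr0.
exists (size w).+1 => k lt; rewrite hcomp_word ltn_eqF ?scale0r //.
Qed.

(** The derivation along [v] is the contraction of the coproduct with the form
    of [v], so relations between the forms are relations between derivations. *)
Lemma rders_eq (T : finType) (P : pred T) (f : T -> seq X) (c : T -> K) v x :
  (forall y, word_form v y = \sum_(w | P w) c w * word_form (f w) y) ->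
  rders v x = \sum_(w | P w) c w *: rders (f w) x.
Proof.
move=> e; pose S z := contractr nil (tmap idfun (rders v) z) =
  \sum_(w | P w) c w *: contractr nil (tmap idfun (rders (f w)) z).
have /(_ (coprod x)) : forall z, S z.
  elim/tens_ind => [|a p q hp hq|u y]; rewrite /S.
  - by rewrite !linear0 big1 // => w _; rewrite !linear0.
  - rewrite !linearP /= hp hq scaler_sumr -big_split; apply: eq_bigr => w _ /=.
    by rewrite !linearP.
  rewrite tmapE contractrE -/(word_form v << y >>) e scaler_suml.
  by apply: eq_bigr => w _; rewrite tmapE contractrE -scalerA.
rewrite /S -coprod_rders coprod_counitr => ->.
by apply: eq_bigr => w _; rewrite -coprod_rders [contractr _ _]coprod_counitr.
Qed.

Lemma lder_gmul_id t x : op t t = t ->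
  lder t (gmul t x) = x + chi t t *: gmul t (lder t x).
Proof. by move=> tt; have := lder_gmul t t x; rewrite tt eqxx scale1r. Qed.

Lemma iter_linear (f : {linear TV -> TV}) k : linear (iter k f).
Proof. by move=> a x y; elim: k => //= k ->; rewrite linearP. Qed.

(** The q-Leibniz rule for powers, with q = [chi t t]. *)
Lemma iter_lder_gmul_id k t x : op t t = t ->
  iter k.+1 (lder t) (gmul t x) =
  (\sum_(i < k.+1) chi t t ^+ i) *: iter k (lder t) x +
  chi t t ^+ k.+1 *: gmul t (iter k.+1 (lder t) x).
Proof.
have collect (V : lmodType K) (a b q : K) (u v : V) :
    a *: u + b *: (u + q *: v) = (a + b) *: u + (b * q) *: v.
  by rewrite scalerDr addrA -scalerDl scalerA.
move=> tt; elim: k => [|k IH].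
  by rewrite big_ord1 expr0 scale1r expr1; apply: lder_gmul_id.
rewrite iterS IH [LHS]linearD /= [lder t (_ *: iter _ _ _)]linearZ.
rewrite [lder t (_ *: gmul _ _)]linearZ /= (lder_gmul_id _ tt).
rewrite [in RHS]big_ord_recr [chi t t ^+ k.+2]exprSr.
exact: collect.
Qed.

Lemma iter_lder_gmul_neq k s r x : s != op s r ->
  iter k (lder (op s r)) (gmul s x) = chi s r ^+ k *: gmul s (iter k (lder r) x).
Proof.
move=> ne; elim: k => [|k IH]; first by rewrite expr0 scale1r.
rewrite iterS IH [LHS]linearZ /= lder_gmul (negbTE ne) scale0r add0r.
by rewrite scalerA -exprSr.
Qed.

(** By the q-Leibniz rule the only obstruction is the coefficient
    1 + q + ... + q^(m-1), which vanishes as q <> 1 and q^m = 1. *)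
Lemma lder_nilpotent m t x : (1 < m)%N -> (forall s, op s s = s) ->
  (forall s, m.-primitive_root (chi s s)) -> iter m (lder t) x = 0.
Proof.
move=> m1 idem prim; elim/tensor_ind: x t => [|a u v hu hv||s u hu] t.
- by rewrite (linear_fun0 (iter_linear _ m)).
- by rewrite (iter_linear _ m) hu hv scaler0 addr0.
- by case: m m1 {prim} => // m _; rewrite iterSr lder1 (linear_fun0 (iter_linear _ m)).
have [g _ gK] := rack.2 s; have [e|ne] := eqVneq s t; last first.
  by rewrite -(gK t) iter_lder_gmul_neq ?gK // hu linear0 scaler0.
rewrite -{t}e; case: m m1 prim hu => // m m1 prim hu.
rewrite iter_lder_gmul_id // hu linear0 scaler0 addr0.
suff -> : \sum_(i < m.+1) chi s s ^+ i = 0 by rewrite scale0r.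
have /eqP := subrX1 (chi s s) m.+1; rewrite (prim_expr_order (prim s)) subrr eq_sym.
rewrite mulf_eq0 subr_eq0 => /orP[/eqP q1|/eqP //].
have := prim_order_dvd (prim s) 1; rewrite expr1 q1 eqxx.
by rewrite dvdn1 => /eqP [m0]; rewrite m0 in m1.
Qed.

(** * The projection onto the words of a subrack *)

Section Subrack.

Variable Y : {set X}.
Hypothesis YP : forall t s, t \in Y -> (op t s \in Y) = (s \in Y).

(** The algebra projection that sends the generators outside of [Y] to zero. *)
Definition subproj : TV -> TV :=
  linext (fun w : word => (all (mem Y) w)%:R *: (<< w >> : TV)).

HB.instance Definition _ := GRing.Linear.on subproj.

Lemma subproj_word (w : seq X) :
  subproj << FMonom w >> = (all (mem Y) w)%:R *: << FMonom w >>.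
Proof. by rewrite /subproj linextU. Qed.

Lemma subproj1 : subproj 1 = 1.
Proof. by rewrite word1 subproj_word scale1r. Qed.

Lemma subproj_gmul t x : subproj (gmul t x) = (t \in Y)%:R *: gmul t (subproj x).
Proof.
elim/malg_ind: x => [|a u v hu hv|[w]].
- by rewrite !linear0.
- by rewrite !linearP /= hu hv.
rewrite gmul_word !subproj_word linearZ /= gmul_word scalerA -natrM mulnb.
by [].
Qed.

Lemma subproj_act t x : t \in Y -> subproj (act t x) = act t (subproj x).
Proof.
move=> tY; elim/tensor_ind: x => [|a u v hu hv||s u hu].
- by rewrite !linear0.
- by rewrite !linearP /= hu hv.
- by rewrite Defs.act1 subproj1 Defs.act1.
rewrite act_gmul linearZ /= !subproj_gmul [act t (_ *: _)]linearZ /= act_gmul hu (YP _ tY).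
by rewrite !scalerA mulrC.
Qed.

(** For [t] in [Y] the action of [t] permutes [Y] and its complement, so [rder t]
    creates no letters in [Y] out of letters outside of it, nor conversely. *)
Lemma rder_subproj t x : t \in Y -> rder t (subproj x) = subproj (rder t x).
Proof.
move=> tY; elim/tensor_ind: x => [|a u v hu hv||s u hu].
- by rewrite !linear0.
- by rewrite !linearP /= hu hv.
- by rewrite subproj1 rder1 linear0.
rewrite subproj_gmul linearZ /= !rder_gmul hu.
rewrite [subproj (_ + _)]linearD /= [subproj (_ *: _)]linearZ /= subproj_gmul (subproj_act _ tY).
rewrite scalerDr; congr (_ + _); case: eqVneq => [->|_]; last by rewrite !scale0r scaler0.
by rewrite tY scale1r.
Qed.

Lemma rder_subproj0 t x : t \notin Y -> rder t (subproj x) = 0.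
Proof.
move=> tY; elim/tensor_ind: x => [|a u v hu hv||s u hu].
- by rewrite !linear0.
- by rewrite !linearP /= hu hv scaler0 addr0.
- by rewrite subproj1 rder1.
rewrite subproj_gmul linearZ /= rder_gmul hu linear0 add0r.
by case: eqVneq => [->|_]; rewrite ?(negbTE tY) scale0r ?scaler0.
Qed.

Lemma mcoeff_subproj_nil x : (subproj x)@_nil = x@_nil.
Proof.
elim/tensor_ind: x => [|a u v hu hv||s u hu]; first by rewrite linear0.
- by rewrite [subproj _]linearP /= !mcoeffD !mcoeffZ hu hv.
- by rewrite subproj1.
by rewrite subproj_gmul mcoeffZ !mcoeff_gmul mulr0.
Qed.

Lemma word_form_subproj w x : word_form w (subproj x) = if all (mem Y) w then word_form w x else 0.
Proof.
elim: w x => [|t w IH] x /=; first by rewrite /word_form /= mcoeff_subproj_nil.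
rewrite -!word_form_rder; have [tY|tY] := boolP (t \in Y); first by rewrite rder_subproj // IH.
by rewrite rder_subproj0 // word_form0.
Qed.

(** With this, [subproj] descends to the Nichols algebra, where its image is the
    Nichols subalgebra ([nichols_subalgebraE]). *)
Lemma radical_subproj x : radical x -> radical (subproj x).
Proof. by move=> hx w; rewrite word_form_subproj hx; case: ifP. Qed.

Lemma subproj_hcomp n x : subproj (hcomp n x) = hcomp n (subproj x).
Proof.
elim/malg_ind: x => [|a u v hu hv|[w]].
- by rewrite !linear0.
- by rewrite !linearP /= hu hv.
by rewrite hcomp_word linearZ /= !subproj_word [hcomp n (_ *: _)]linearZ /= hcomp_word !scalerA mulrC.
Qed.

Lemma subproj_id x : subproj (subproj x) = subproj x.
Proof.
elim/malg_ind: x => [|a u v hu hv|[w]].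
- by rewrite !linear0.
- by rewrite !linearP /= hu hv.
by rewrite subproj_word linearZ /= subproj_word scalerA -natrM mulnb andbb.
Qed.

End Subrack.

End Derivations.

(** * Descent to the Nichols algebra *)

Section Quotient.

Variables (K : fieldType) (X : finType) (op : X -> X -> X) (chi : X -> X -> K).
Hypotheses (rack : is_rack op) (coc : cocycle op chi).
Variables (B : falgType K) (pi : {lrmorphism tensor_algebra K X -> B}).
Hypothesis nichols : is_nichols_algebra op chi pi.

Local Notation word := {fmonom X}.
Local Notation TV := (tensor_algebra K X).
Local Notation act := (Defs.act op chi).
Local Notation gen := (gen K).
Local Notation nil := (FMonom [::] : word).
Local Notation letter t := (FMonom [:: t] : word).
Local Notation rder := (rder op chi).
Local Notation lder := (lder op chi).
Local Notation rders := (rders op chi).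
Local Notation word_form := (word_form op chi).
Local Notation radical := (radical op chi).
Local Notation hcomp := (@hcomp K X).
Local Notation grade := (grade pi).

Lemma pi_eq0 x : pi x = 0 <-> radical x.
Proof.
split=> [/(nichols.2 x)|/(nichols_idealE rack coc x)/(nichols.2 x)//].
exact: (nichols_idealE rack coc x).1.
Qed.

Lemma pi_section : exists2 s : B -> TV, linear s & forall b, pi (s b) = b.
Proof.
have /fin_all_exists[r rK] : forall i : 'I_(\dim {:B}), exists x, pi x = (vbasis {:B})`_i.
  by move=> i; apply: nichols.1.
exists (fun b => \sum_i coord (vbasis {:B}) i b *: r i) => [a x y|b].
  rewrite scaler_sumr -big_split; apply: eq_bigr => i _ /=.
  by rewrite linearP /= scalerDl scalerA.
rewrite linear_sum [RHS](coord_vbasis (memvf b)); apply: eq_bigr => i _ /=.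
by rewrite linearZ /= rK.
Qed.

Lemma descend_hom (U : vectType K) (f : TV -> U) : linear f ->
  (forall x, radical x -> f x = 0) ->
  exists F : {linear B -> U}, forall x, F (pi x) = f x.
Proof.
move=> flin f0; have [s slin sK] := pi_section.
have glin : linear (f \o s) by move=> a x y /=; rewrite slin flin.
pose g : {linear B -> U} := HB.pack (f \o s) (GRing.isLinear.Build K B U *:%R _ glin).
exists g => x; rewrite /g /=; apply/eqP; rewrite -subr_eq0 -[f x]scale1r -scaleN1r.
have -> : 1 *: f x = f x by rewrite scale1r.
rewrite addrC -flin f0 //; apply/pi_eq0.
by rewrite linearP /= sK scaleN1r addNr.
Qed.

Lemma descend (f : TV -> TV) : linear f ->
  (forall x, radical x -> radical (f x)) ->
  exists F : 'End(B), forall x, F (pi x) = pi (f x).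
Proof.
move=> flin fr; have [||F FE] := @descend_hom B (pi \o f).
- by move=> a x y /=; rewrite flin linearP.
- by move=> x /fr hx /=; apply/pi_eq0.
by exists (linfun F) => x; rewrite lfunE; apply: FE.
Qed.

Lemma pi_surj b : exists x, pi x = b.
Proof. exact: nichols.1. Qed.

Lemma grade_pi n x : pi (hcomp n x) \in grade n.
Proof.
elim/malg_ind: x => [|a x y hx hy|[w]].
- by rewrite !linear0 mem0v.
- by rewrite !linearP /= memvD ?memvZ.
rewrite hcomp_word; case: eqP => [sz|_]; last by rewrite scale0r linear0 mem0v.
rewrite scale1r; apply: memv_span; apply/mapP.
by exists (Tuple (introT eqP sz)); rewrite ?mem_enum.
Qed.

Lemma grade_ex n b : b \in grade n -> exists x, b = pi (hcomp n x).
Proof.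
move=> bn.
have [P PE] := descend (@hcomp_linear K X n) (adm_hcomp (radical_admissible rack coc) n).
suff sub : (grade n <= limg P)%VS.
  have /memv_imgP[c _ ->] := subvP sub _ bn; have [x <-] := pi_surj c.
  by exists x.
apply/span_subvP => _ /mapP[w _ ->].
have -> : pi << FMonom (val w) >> = P (pi << FMonom (val w) >>).
  by rewrite PE hcomp_word size_tuple eqxx scale1r.
exact/memv_img/memvf.
Qed.

(** A basis of [B] lifts to finitely many tensors, and these have bounded
    degree. *)
Lemma grade_vanish : exists N, forall j, (N <= j)%N -> grade j = 0%VS.
Proof.
have [s slin sK] := pi_section.
have /fin_all_exists[n nP] : forall i : 'I_(\dim {:B}), exists n : nat,
    forall k, (n <= k)%N -> hcomp k (s (vbasis {:B})`_i) = 0.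
  by move=> i; apply: hcomp_large.
exists (\max_i n i)%N => j le; apply/eqP; rewrite -subv0; apply/subvP => b /grade_ex[x ->].
rewrite memv0; apply/eqP/pi_eq0.
have [P PE] := descend (@hcomp_linear K X j) (adm_hcomp (radical_admissible rack coc) j).
apply/pi_eq0; rewrite -PE (coord_vbasis (memvf (pi x))) linear_sum big1 // => i _.
by rewrite linearZ /= -[X in P X]sK PE nP ?linear0 ?scaler0 // (leq_trans (leq_bigmax i)).
Qed.

Lemma hilbert_series_ex U : exists H, hilbert_series pi U H.
Proof.
have [N gr0] := grade_vanish; exists (\poly_(j < N) (\dim (U :&: grade j))%:Z) => j.
by rewrite coef_poly; case: ltnP => // /gr0 ->; rewrite capv0 dimv0.
Qed.

Lemma rders_vanish : exists N, forall w x, (N <= size w)%N -> pi (rders w x) = 0.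
Proof.
have [N gr0] := grade_vanish; exists N => w x le; apply/pi_eq0 => v.
rewrite word_form_rders; set u := w ++ v.
have -> : word_form u x = word_form u (hcomp (size u) x) by rewrite word_form_hcomp eqxx.
suff /pi_eq0 -> : pi (hcomp (size u) x) = 0 by [].
apply/eqP; rewrite -memv0 -(gr0 (size u)) ?grade_pi //.
by rewrite /u size_cat (leq_trans le) ?leq_addr.
Qed.

(** * The Nichols algebra as a free module over its subalgebra *)

Section Subalgebra.

Variable Y : {set X}.
Hypothesis YP : forall t s, t \in Y -> (op t s \in Y) = (s \in Y).

Local Notation subproj := (@subproj K X Y).
Local Notation inY w := (all (mem Y) w).
Local Notation B' := (nichols_subalgebra pi Y).

Lemma word_form_pi w x y : pi x = pi y -> word_form w x = word_form w y.
Proof.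
move=> e; apply/eqP; rewrite -subr_eq0 -word_formB; apply/eqP.
by have /pi_eq0/(_ w) : pi (x - y) = 0 by rewrite linearB /= e subrr.
Qed.

Lemma pi_gmul t x : pi (gmul t x) = pi (gen t) * pi x.
Proof. by rewrite gmulE rmorphM. Qed.

Lemma nichols_subalgebraE (R : 'End(B)) :
  (forall x, R (pi x) = pi (subproj x)) -> B' = limg R.
Proof.
move=> RE; apply/eqP; rewrite eqEsubv; apply/andP; split.
  apply: agenv_sub_modl.
    have R1 : R (pi 1) = 1 by rewrite RE subproj1 rmorph1.
    by rewrite -memvE -R1 memv_img ?memvf.
  apply/prodvP => u _ uY /memv_imgP[c _ ->]; have [x <-] := pi_surj c.
  suff /subvP/(_ _ uY) : (<<[seq pi (gen t) | t in Y]>> <= amulr (R (pi x)) @^-1: limg R)%VS.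
    by rewrite -memv_preim lfunE.
  apply/span_subvP => _ /mapP[t /[!mem_enum] tY ->]; rewrite -memv_preim lfunE /=.
  have -> : pi (gen t) * R (pi x) = R (pi (gmul t x)).
    by rewrite !RE subproj_gmul tY scale1r pi_gmul.
  exact/memv_img/memvf.
apply/subvP => _ /memv_imgP[c _ ->]; have [x <-] := pi_surj c; rewrite RE.
elim/tensor_ind: x => [|a x y hx hy||t x hx].
- by rewrite !linear0 mem0v.
- by rewrite !linearP /= memvD ?memvZ.
- by rewrite subproj1 rmorph1 memvE sub1_agenv.
rewrite subproj_gmul linearZ /=; have [tY|_] := boolP (t \in Y); last by rewrite scale0r mem0v.
rewrite scale1r pi_gmul /nichols_subalgebra agenvEl.
apply: (subvP (addvSr _ _)); apply: memv_mul => //.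
by apply: memv_span; apply: map_f; rewrite mem_enum.
Qed.

Lemma memv_subalgebra_grade n b :
  b \in (B' :&: grade n)%VS <-> exists x, b = pi (subproj (hcomp n x)).
Proof.
have subproj_lin : linear subproj by move=> a x y; apply: linearP.
have [R RE] := descend subproj_lin (fun x => @radical_subproj _ _ op chi Y YP x).
rewrite memv_cap (nichols_subalgebraE RE); split=> [/andP[]|[x ->]].
  move=> /memv_imgP[c _ bE] /(grade_ex)[x bx]; exists x.
  rewrite -RE -bx bE; have [y <-] := pi_surj c.
  by rewrite !RE subproj_id.
by rewrite -RE memv_img ?memvf //= RE subproj_hcomp grade_pi.
Qed.

(** The derivations along words in [Y] separate the points of the subalgebra,
    since all other derivations annihilate tensors in the letters of [Y], and
    only the radical is annihilated by all derivations. *)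
Lemma dual_words n : exists c : 'I_(\dim (B' :&: grade n)%VS) -> n.-tuple X -> K,
  forall i x, pi x \in (B' :&: grade n)%VS ->
    \sum_(w : n.-tuple X | inY w) c i w * word_form w x = coord (vbasis (B' :&: grade n)) i (pi x).
Proof.
have /fin_all_exists[lam lamE] : forall w : n.-tuple X,
    exists l : {linear B -> K^o}, forall x, l (pi x) = word_form w x.
  move=> w; apply: (@descend_hom K^o (word_form w)) => [a x y|x].
    by rewrite word_formP.
  exact.
have [] := @dual_functionals K B (B' :&: grade n)%VS (n.-tuple X) lam.
  move=> _ /memv_subalgebra_grade[x ->] lam0; apply/pi_eq0 => w.
  rewrite subproj_hcomp word_form_hcomp; case: eqP => // sz.
  have := lam0 (Tuple (introT eqP sz)); rewrite lamE subproj_hcomp word_form_hcomp /= sz eqxx.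
  by [].
move=> c cE; exists c => i x xB; rewrite -cE // [RHS](bigID (fun w : n.-tuple X => inY w)) /=.
rewrite [X in _ + X]big1 ?addr0 => [|w /negbTE wY].
  by apply: eq_bigr => w _; rewrite lamE.
by move: xB => /memv_subalgebra_grade[y ->]; rewrite lamE word_form_subproj // wY mulr0.
Qed.

Definition word_op n (c : n.-tuple X -> K) (x : TV) : TV :=
  \sum_(w : n.-tuple X | inY w) c w *: rders w x.

Lemma word_op_linear n c : linear (@word_op n c).
Proof.
have aux (V : lmodType K) (a b : K) (u v : V) : b *: (a *: u + v) = a *: (b *: u) + b *: v.
  by rewrite scalerDr !scalerA mulrC.
move=> a x y; rewrite /word_op scaler_sumr -big_split; apply: eq_bigr => w _ /=.
by rewrite [rders w _]linearP /= aux.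
Qed.

Lemma radical_word_op n c x : radical x -> radical (@word_op n c x).
Proof.
move=> hx; rewrite /word_op; elim/big_rec: _ => [|w y _ hy]; first exact: radical0.
by apply: radicalP => //; apply: radical_rders.
Qed.

Lemma pi_word_op n c x :
  pi (@word_op n c x) = \sum_(w : n.-tuple X | inY w) c w *: pi (rders w x).
Proof. by rewrite linear_sum; apply: eq_bigr => w _; rewrite linearZ. Qed.

(** In degree [n] the derivations along words in [Y] are linear combinations of
    those dual to a basis of the subalgebra, not only on the subalgebra but on
    all of [B]: by [rders_eq] it suffices to compare the forms on words, and
    words with a letter outside of [Y] contribute to neither side. *)
Lemma rders_dual n c :
  (forall i x, pi x \in (B' :&: grade n)%VS ->
    \sum_(w : n.-tuple X | inY w) c i w * word_form w x =
    coord (vbasis (B' :&: grade n)) i (pi x)) ->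
  forall v : n.-tuple X, inY v ->
  exists l, forall x, pi (rders v x) = \sum_i l i *: pi (word_op (c i) x).
Proof.
move=> cE v vY.
have /fin_all_exists[y yE] : forall i : 'I_(\dim (B' :&: grade n)%VS),
    exists y, pi y = (vbasis (B' :&: grade n))`_i.
  by move=> i; apply: pi_surj.
exists (fun i => word_form v (y i)) => x.
rewrite (@rders_eq _ _ op chi rack coc (n.-tuple X) (fun w : n.-tuple X => inY w) val
   (fun w => \sum_i word_form v (y i) * c i w)); last first.
  move=> z; pose u := subproj (hcomp n z).
  have uE (w : n.-tuple X) : inY w -> word_form w z = word_form w u.
    by move=> wY; rewrite /u word_form_subproj // wY word_form_hcomp size_tuple eqxx.
  have uB : pi u \in (B' :&: grade n)%VS by apply/memv_subalgebra_grade; exists z.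
  rewrite uE // (@word_form_pi _ _ (\sum_i coord (vbasis (B' :&: grade n)) i (pi u) *: y i)).
    rewrite word_form_sum (eq_bigr (fun i => \sum_(w : n.-tuple X | inY w)
        word_form v (y i) * c i w * word_form w z)) => [|i _].
      by rewrite exchange_big; apply: eq_bigr => w _; rewrite mulr_suml.
    rewrite word_formZ -cE // mulr_suml; apply: eq_bigr => w wY.
    by rewrite uE // mulrC mulrA.
  rewrite linear_sum [LHS](coord_vbasis uB); apply: eq_bigr => i _.
  by rewrite linearZ /= yE.
rewrite linear_sum (eq_bigr (fun w : n.-tuple X =>
    \sum_i word_form v (y i) *: (c i w *: pi (rders w x)))) => [|w _].
  rewrite exchange_big; apply: eq_bigr => i _.
  by rewrite pi_word_op scaler_sumr.
by rewrite linearZ /= scaler_suml; apply: eq_bigr => i _; rewrite scalerA.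
Qed.

(** The Leibniz rule produces, besides the stated one, only terms with a derivative of [x]. *)
Lemma pi_rders_mul w x y : inY w -> (forall s, s \in Y -> pi (rder s x) = 0) ->
  pi (rders w (x * y)) = pi x * pi (rders w y).
Proof.
move=> + x0; elim: w y => [|s w IH] y /=; first by rewrite rmorphM.
move=> /andP[sY wY]; rewrite (rderM op chi s x y).
rewrite [rders w _]linearD /= [LHS]rmorphD /=.
rewrite [X in _ + X](_ : _ = 0) ?addr0; first exact: IH.
by apply/pi_eq0; apply: radical_rders => //; apply: radicalMr => //; apply/pi_eq0/x0.
Qed.

(** These are the right coinvariants of [B] with respect to the subalgebra. *)
Definition is_coinvariants (W : {vspace B}) :=
  forall x, pi x \in W <-> (forall s, s \in Y -> pi (rder s x) = 0).

(** The translates of [W] are the [W * b] with [b] in a homogeneous basis of the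
    subalgebra; the dual operators are the linear combinations of derivations
    along words in [Y] that [dual_words] provides. *)
Lemma hilbert_coinvariants W H H' HW : is_coinvariants W ->
  hilbert_series pi fullv H -> hilbert_series pi B' H' -> hilbert_series pi W HW ->
  H = H' * HW.
Proof.
move=> WE HE HE' HWE.
have [N0 N0P] := grade_vanish.
have [N1 N1P] := rders_vanish.
pose N := (maxn N0 N1).+1.
pose d (j : 'I_N) := \dim (B' :&: grade j)%VS.
pose bas (j : 'I_N) (i : 'I_(d j)) := (vbasis (B' :&: grade j)%VS)`_i.
have /fin_all_exists[c cP] := fun j : 'I_N => dual_words j.
pose I : finType := {j : 'I_N & 'I_(d j)}.
have /fin_all_exists[phi phiE] : forall p : I, exists F : 'End(B),
    forall x, F (pi x) = pi (word_op (c (tag p) (tagged p)) x).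
  move=> p; apply: (descend); first exact: word_op_linear.
  exact: radical_word_op.
have bas_in j (i : 'I_(d j)) : bas j i \in (B' :&: grade j)%VS.
  by rewrite vbasis_mem // mem_nth // size_tuple.
(* From degree [N] on all derivations vanish; below, [rders_dual] applies. *)
have expand (v : seq X) x : inY v -> (forall p : I, size v = tag p -> phi p (pi x) = 0) ->
    pi (rders v x) = 0.
  move=> vY phi0; have [leN|ltN] := leqP N (size v).
    by apply: N1P; apply: leq_trans leN; rewrite leqW // leq_maxr.
  have [l ->] := @rders_dual _ _ (cP (Ordinal ltN)) (in_tuple v) vY.
  rewrite big1 // => i _.
  by rewrite -(phiE (Tagged (fun j : 'I_N => 'I_(d j)) i)) phi0 ?scaler0.
have -> : H' = \sum_(p : I) 'X^(tag p).
  rewrite -(@sig_big_dep _ _ _ _ _ predT (fun _ => predT) (fun j _ => 'X^(val j))) /=.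
  apply/polyP => n; rewrite HE' coef_sum.
  rewrite (eq_bigr (fun j : 'I_N => (d j)%:Z *+ (n == j))) => [|j _].
    have [ltn|leN] := ltnP n N.
      rewrite (bigD1 (Ordinal ltn)) //= eqxx big1 ?addr0 // => j ne.
      by case: (n =P _) => // e; case/eqP: ne; apply/val_inj.
    rewrite big1 => [|j _]; last by rewrite gtn_eqF // (leq_trans (ltn_ord j)).
    rewrite N0P ?capv0 ?dimv0 //.
    by apply: leq_trans leN; rewrite leqW // leq_maxl.
  rewrite sumr_const card_ord coefMn coefXn.
  by case: (n == j); rewrite ?mulr1n ?mul0rn ?mulr0n ?natz.
apply: (graded_decomposition (gr := grade) (U := fullv) (W := W)
  (f := fun p : I => amulr (bas (tag p) (tagged p))) (phi := phi)) => //.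
- move=> p n w /[!memv_cap]/andP[_ /(grade_ex)[x ->]].
  rewrite memvf lfunE /=; have /memv_capP[_] := bas_in _ (tagged p).
  move=> /(grade_ex)[y ->].
  by rewrite -rmorphM -hcompM; apply: grade_pi.
- move=> p n _ /(grade_ex)[x ->]; rewrite phiE pi_word_op.
  apply: memv_suml => w _; rewrite memvZ // rders_hcomp size_tuple leq_addl addnK.
  exact: grade_pi.
- move=> p n _ lt /(grade_ex)[x ->]; rewrite phiE pi_word_op.
  by rewrite big1 // => w _; rewrite rders_hcomp size_tuple leqNgt lt linear0 scaler0.
- move=> [a i] [j k] b bW; rewrite lfunE /= => leja.
  have [x xb] := pi_surj b; rewrite -xb in bW *; have x0 := (WE x).1 bW.
  have [y ye] := (memv_subalgebra_grade j _).1 (bas_in j k).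
  rewrite ye -rmorphM phiE pi_word_op /=.
  rewrite (eq_bigr (fun w : a.-tuple X =>
      c a i w *: (pi x * pi (rders w (subproj (hcomp j y)))))) => [|w wY].
    2: by rewrite (pi_rders_mul _ wY x0).
  have [e|ne] := eqVneq a j; last first.
    rewrite big1 => [|w _]; last first.
      rewrite subproj_hcomp rders_hcomp size_tuple leqNgt ltn_neqAle leja andbT.
      by rewrite (inj_eq val_inj) eq_sym ne linear0 mulr0 scaler0.
    by case: eqP => // /(congr1 tag)/= e; rewrite e eqxx in ne.
  subst j; pose z := subproj (hcomp a y).
  have zB : pi z \in (B' :&: grade a)%VS by rewrite -ye bas_in.
  rewrite (eq_bigr (fun w : a.-tuple X => (c a i w * word_form w z) *: pi x)) => [|w _].
    2: {
      rewrite /z subproj_hcomp rders_hcomp size_tuple leqnn subnn hcomp0E word_form_hcomp.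
      by rewrite size_tuple eqxx linearZ rmorph1 /= -scalerAr mulr1 scalerA.
    }
  rewrite -scaler_suml cP // -ye coord_free ?(basis_free (vbasisP _)) // eq_sym.
  have -> : (existT _ a i == existT _ a k :> I) = (i == k).
    by rewrite -[existT _ a k]/(Tagged (fun j : 'I_N => 'I_(d j)) k) eq_Tagged.
  by case: eqP; rewrite ?scale1r ?scale0r.
- move=> p b _ phi0; have [x xb] := pi_surj b; rewrite -xb in phi0 *.
  rewrite phiE; apply/WE => s sY; rewrite /word_op linear_sum linear_sum big1 // => w wY.
  rewrite linearZ linearZ /= -rders_rcons (expand (rcons w s)) ?scaler0 //.
    by rewrite all_rcons wY andbT.
  by move=> q; rewrite size_rcons size_tuple => sq; apply: phi0; rewrite -sq.
- move=> b _ phi0; have [x xb] := pi_surj b; rewrite -xb in phi0 *.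
  exact: (expand [::]).
Qed.

(** * The contribution of a generator outside of the subrack *)

(** The relation gives L (e^n w) = (n)_q e^(n-1) w whenever L w = 0. *)
Lemma q_weyl_iter (e : B) (L : 'End(B)) (q : K) :
  (forall b, L (e * b) = b + q *: (e * L b)) ->
  forall j k w, L w = 0 -> (j <= k)%N ->
  iter k L (e ^+ j * w) =
    if k == j then (\prod_(i < j) \sum_(l < i.+1) q ^+ l) *: w else 0.
Proof.
move=> Le j k w Lw.
have lin n : linear (iter n L).
  by move=> a x y; elim: n => //= n ->; rewrite linearP.
have lin0 n : iter n L 0 = 0 by elim: n => //= n ->; rewrite linear0.
have LeX n : L (e ^+ n.+1 * w) = (\sum_(l < n.+1) q ^+ l) *: (e ^+ n * w).
  elim: n => [|n IH]; first by rewrite expr1 Le Lw mulr0 scaler0 addr0 big_ord1 !expr0 scale1r mul1r.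
  rewrite exprS -mulrA Le IH -scalerAr mulrA -exprS scalerA -[X in X + _]scale1r -scalerDl.
  rewrite [in RHS]big_ord_recl expr0 mulr_sumr; congr ((_ + _) *: _).
  by apply: eq_bigr => l _; rewrite -exprS.
elim: j k => [|j IH] [|k] //.
- by rewrite big_ord0 scale1r expr0 mul1r.
- by rewrite expr0 mul1r iterSr Lw lin0.
move=> le; rewrite iterSr LeX -[_ *: _]addr0 lin lin0 addr0 IH // eqSS.
by case: eqP => _; rewrite ?scaler0 // scalerA [\prod_(i < j.+1) _]big_ord_recr /= mulrC.
Qed.

(** The translates of [W0] are the e_t^i W0 for i < m, and the dual operators
    are the powers of [lder t] divided by the q-factorials, which are nonzero
    below m as q has order m. *)
Lemma hilbert_q_weyl (W W0 : {vspace B}) t m HW HW0 :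
  (forall s, op s s = s) -> (forall s, m.-primitive_root (chi s s)) -> (1 < m)%N ->
  t \notin Y -> is_coinvariants W ->
  (forall x, pi x \in W0 <-> pi x \in W /\ pi (lder t x) = 0) ->
  hilbert_series pi W HW -> hilbert_series pi W0 HW0 ->
  HW = q_number m * HW0.
Proof.
move=> idem prim m1 tY WE W0E HWE HW0E.
pose q := chi t t; pose e := pi (gen t).
pose qfact j := \prod_(i < j) \sum_(l < i.+1) q ^+ l.
have qfact_neq0 j : (j < m)%N -> qfact j != 0.
  move=> ltj; apply/prodf_neq0 => i _; apply/eqP => qi0.
  have : q ^+ i.+1 == 1 by rewrite -subr_eq0 subrX1 qi0 mulr0.
  rewrite -(prim_order_dvd (prim t)) => /(dvdn_leq (ltn0Sn i)).
  by rewrite leqNgt (leq_ltn_trans (ltn_ord i) ltj).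
have lin : linear (lder t) by move=> a x y; apply: linearP.
have [L LE] := descend lin (fun x => @radical_lder _ _ op chi rack coc t x).
have iterE k x : iter k L (pi x) = pi (iter k (lder t) x).
  by elim: k => //= k ->; rewrite LE.
have iter0 k : iter k L 0 = 0 by elim: k => //= k ->; rewrite linear0.
have /fin_all_exists[F FE] : forall k : 'I_m, exists F : 'End(B),
    forall b, F b = (qfact k)^-1 *: iter k L b.
  move=> k; have [||F FE] := @descend (iter k (lder t)).
  - exact: iter_linear.
  - move=> x hx; elim: (val k) => //= n; exact: radical_lder.
  exists ((qfact k)^-1 *: F) => b; have [x <-] := pi_surj b.
  by rewrite scale_lfunE FE iterE.
have Le b : L (e * b) = b + q *: (e * L b).
  have [x <-] := pi_surj b.
  by rewrite -pi_gmul LE lder_gmul_id // linearD linearZ /= LE pi_gmul.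
have memW b : b \in W <-> exists2 x, b = pi x & forall s, s \in Y -> pi (rder s x) = 0.
  split=> [|[x -> /WE]//]; have [x <-] := pi_surj b.
  by move=> /WE hx; exists x.
have eW b : b \in W -> e * b \in W.
  move=> /memW[x -> hx]; rewrite -pi_gmul; apply/WE => s sY.
  rewrite rder_gmul linearD linearZ /= pi_gmul hx // mulr0 add0r.
  by case: eqP => [ts|_]; rewrite ?scale0r // ts sY in tY *.
have LW b : b \in W -> L b \in W.
  move=> /memW[x -> hx]; rewrite LE; apply/WE => s sY.
  by rewrite -(lder_rder rack coc) -LE hx // linear0.
have iterLW k b : b \in W -> iter k L b \in W by move=> bW; elim: k => //= k /LW.
have memW0 b : b \in W0 <-> b \in W /\ L b = 0.
  by have [x <-] := pi_surj b; rewrite LE; apply: W0E.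
have e_grade n b : b \in grade n -> e * b \in grade n.+1.
  move=> /(grade_ex)[x ->]; rewrite -pi_gmul -hcomp_gmulS.
  exact: grade_pi.
have L_grade n b : b \in grade n.+1 -> L b \in grade n.
  move=> /(grade_ex)[x ->]; rewrite LE lder_hcompS //.
  exact: grade_pi.
have L_grade0 b : b \in grade 0 -> L b = 0.
  by move=> /(grade_ex)[x ->]; rewrite LE lder_hcomp0 // linear0.
have Lm b : iter m L b = 0.
  have [x <-] := pi_surj b.
  by rewrite iterE (lder_nilpotent rack t x m1 idem prim) linear0.
apply: (graded_decomposition (gr := grade) (U := W) (W := W0) (I := 'I_m)
  (deg := @nat_of_ord m) (f := fun i => amull (e ^+ i)) (phi := F)) => //.
- move=> i n w; rewrite memv_cap => /andP[/memW0[wW _] wn]; rewrite lfunE /=.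
  elim: (nat_of_ord i) => [|k IH]; first by rewrite expr0 mul1r addn0 memv_cap wW.
  move: IH; rewrite !memv_cap => /andP[IW In].
  by rewrite exprS -mulrA eW //= addnS e_grade.
- move=> i n x; rewrite FE => xn; apply: memvZ.
  by elim: (nat_of_ord i) x xn => [|k IH] x; rewrite ?addn0 // addnS iterSr => /L_grade/IH.
- move=> i n x; rewrite FE => lt xn; suff -> : iter i L x = 0 by rewrite scaler0.
  elim: (nat_of_ord i) n x lt xn => // k IH [|n] x lt xn; rewrite iterSr.
    by rewrite L_grade0 // iter0.
  by apply: (IH n) => //; apply: L_grade.
- move=> i j w /memW0[_ Lw] leji; rewrite FE lfunE /= (q_weyl_iter Le) //.
  rewrite (inj_eq val_inj); case: eqP => [->|_]; last by rewrite scaler0.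
  by rewrite scalerA mulVf ?scale1r // qfact_neq0.
- move=> i x xW top; apply/memW0; rewrite FE; split; first by rewrite memvZ ?iterLW.
  rewrite linearZ /= -iterS; have [lt|le] := ltnP i.+1 m.
    have /eqP := top (Ordinal lt) (ltnSn i).
    by rewrite FE scaler_eq0 invr_eq0 (negbTE (qfact_neq0 _ lt)) /= => /eqP ->; rewrite scaler0.
  have -> : i.+1 = m by apply/eqP; rewrite eqn_leq ltn_ord le.
  by rewrite Lm scaler0.
- move=> x xW /(_ (Ordinal (ltnW m1))) /eqP.
  rewrite FE scaler_eq0 invr_eq0 (negbTE (qfact_neq0 _ (ltnW m1))) /=.
  by move=> /eqP.
Qed.

End Subalgebra.

End Quotient.

(** * Divisibility of the Hilbert series *)

(** The restriction of [op t] to [Y] is a bijection of [Y], and [op t] is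
    injective, so nothing outside of [Y] is sent into it. *)
Lemma subrack_mem (X : finType) (op : X -> X -> X) (Y : {set X}) :
  is_rack op -> subrack op Y ->
  forall t s, t \in Y -> (op t s \in Y) = (s \in Y).
Proof.
move=> rack [opY opYE rackY] t s tY; apply/idP/idP => [opY_in|sY].
  have [g gK Kg] := rackY.2 (Sub t tY).
  have := opYE (Sub t tY) (g (Sub (op t s) opY_in)); rewrite Kg /=.
  by move=> /(bij_inj (rack.2 t)) ->; apply: valP.
by have := opYE (Sub t tY) (Sub s sY) => /= <-; apply: valP.
Qed.

Theorem theorem3 (K : fieldType) (X : finType) (op : X -> X -> X)
    (chi : X -> X -> K) (m : nat)
    (B : falgType K) (pi : {lrmorphism tensor_algebra K X -> B})
    (Y : {set X}) :
  is_quandle op -> faithful_rack op -> indecomposable op ->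
  cocycle op chi -> (forall t, m.-primitive_root (chi t t)) ->
  is_nichols_algebra op chi pi ->
  subrack op Y -> Y != set0 -> Y \proper [set: X] ->
  exists H H' : {poly int},
    [/\ hilbert_series pi fullv H,
        hilbert_series pi (nichols_subalgebra pi Y) H'
      & exists Q : {poly int}, H = q_number m * H' * Q].
Proof.
move=> [rack idem] _ _ coc prim nichols subY _ /properP[_ [t _ tY]].
have YP := subrack_mem rack subY.
have [H HE] := hilbert_series_ex rack coc nichols fullv.
have [H' HE'] := hilbert_series_ex rack coc nichols (nichols_subalgebra pi Y).
exists H, H'; split=> //.
have /fin_all_exists[D DE] : forall s : X, exists F : 'End(B),
    forall x, F (pi x) = pi (rder op chi s x).
  move=> s; apply: (descend rack coc nichols) => [a x y|x]; first exact: linearP.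
  exact: radical_rder.
pose W := (\bigcap_(s in Y) lker (D s))%VS.
have WE : is_coinvariants op chi pi Y W.
  move=> x; rewrite memvE; split=> [/subv_bigcapP h s sY|h].
    by have := h s sY; rewrite -memvE memv_ker DE => /eqP.
  by apply/subv_bigcapP => s sY; rewrite -memvE memv_ker DE h.
have [HW HWE] := hilbert_series_ex rack coc nichols W.
rewrite (hilbert_coinvariants rack coc nichols YP WE HE HE' HWE).
(* For [m = 1] the factor (m)_t is 1, and [lder t] need not vanish on [W]. *)
have [m1|m1] := ltnP 1 m; last first.
  have -> : m = 1%N by apply/eqP; rewrite eqn_leq m1 (prim_order_gt0 (prim t)).
  by exists HW; rewrite /q_number big_ord1 expr0 mul1r.
have [L LE] : exists F : 'End(B), forall x, F (pi x) = pi (lder op chi t x).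
  apply: (descend rack coc nichols) => [a x y|x]; first exact: linearP.
  exact: radical_lder.
have [HW0 HW0E] := hilbert_series_ex rack coc nichols (W :&: lker L).
have W0E x : pi x \in (W :&: lker L)%VS <-> pi x \in W /\ pi (lder op chi t x) = 0.
  by rewrite memv_cap memv_ker LE; split=> [/andP[xW /eqP]|[-> /eqP]] //; split.
exists HW0; rewrite (hilbert_q_weyl rack coc nichols idem prim m1 tY WE W0E HWE HW0E).
by rewrite mulrA [H' * _]mulrC.
Qed.
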